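(* Assume $0<S<\min(m,J)$. The operator $A:\operatorname{dom}A\subset\mathcal{H}\to\mathcal{H}$ defined in the context is unbounded, closed and nonselfadjoint.
   Context: Constants: $L,m,J,S,E,G,C_p,R,k_1,k_2,C_I>0$ and $C_D<0$ are real, and $D:=mJ-S^2>0$. State space: $\mathcal{H}$ is the Hilbert space of all $f=(f_0,f_1,f_2,f_3,f_4)$ with $f_0\in H^2((0,L))$, $f_1,f_3\in L^2([0,L])$, $f_2\in H^1((0,L))$, $f_4\in\mathbb{C}$ (complex valued), $f_0(0)=f_0'(0)=f_2(0)=0$, with inner product $$\langle f,g\rangle=\tfrac12\int_0^L\left[Ef_0''\bar g_0''+mf_1\bar g_1+Gf_2'\bar g_2'+Jf_3\bar g_3+S(f_1\bar g_3+f_3\bar g_1)\right]dx+\tfrac12C_pf_4\bar g_4 .$$ Operator: $A$ acts by $$Af=\Big(-if_1,\ \ i\tfrac{EJ}{D}f_0''''+i\tfrac{GS}{D}f_2'',\ \ -if_3,\ \ -i\tfrac{ES}{D}f_0''''-i\tfrac{Gm}{D}f_2'',\ \ i\tfrac{C_D}{C_p}f_1'(L)+\tfrac{i}{C_pR}f_4\Big)$$ on the domain $\operatorname{dom}A$ of all $f\in\mathcal{H}$ with $f_0\in H^4((0,L))$, $f_1,f_2\in H^2((0,L))$, $f_3\in H^1((0,L))$, $f_4\in\mathbb{C}$, $f_1(0)=f_1'(0)=f_3(0)=0$, $f_0'''(L)=0$, $Ef_0''(L)+k_1f_1'(L)+C_If_4=0$, $Gf_2'(L)+k_2f_3(L)=0$.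 *)

(* Defs.v *)
From HB Require Import structures.
From mathcomp Require Import all_boot all_order all_algebra.
From mathcomp Require Import all_classical all_reals all_analysis.
From mathcomp.real_closed Require Import complex.

Set Implicit Arguments.
Unset Strict Implicit.
Unset Printing Implicit Defensive.

Import Order.TTheory GRing.Theory Num.Theory.
Import numFieldNormedType.Exports.

Local Open Scope classical_set_scope.
Local Open Scope ring_scope.

(** A space of function classes is given by representatives: a vector space [V]
    of functions, the set [H] of representatives, the relation [eqH] of equality
    of classes, and an inner product [dot], linear in its first argument.  An
    operator is a domain [dom], a set of representatives, together with a
    function [A] that is only relevant on [dom]. *)

Definition hnorm (R : realType) (V : lmodType R[i]) (dot : V -> V -> R[i])
    (f : V) : R :=
  Num.sqrt (complex.Re (dot f f)).

Definition hcvg (R : realType) (V : lmodType R[i]) (dot : V -> V -> R[i])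
    (u : nat -> V) (f : V) : Prop :=
  hnorm dot (u n - f) @[n --> \oo] --> (0 : R).

Definition bounded_operator (R : realType) (V : lmodType R[i])
    (dot : V -> V -> R[i]) (dom : set V) (A : V -> V) : Prop :=
  exists M : R, forall f, dom f -> hnorm dot (A f) <= M * hnorm dot f.

Definition closed_operator (R : realType) (V : lmodType R[i]) (H : set V)
    (eqH : V -> V -> Prop) (dot : V -> V -> R[i]) (dom : set V) (A : V -> V)
    : Prop :=
  forall (u : nat -> V) (f g : V), (forall n, dom (u n)) -> H f -> H g ->
    hcvg dot u f -> hcvg dot (fun n => A (u n)) g ->
    dom f /\ eqH (A f) g.

Definition densely_defined (R : realType) (V : lmodType R[i]) (H : set V)
    (dot : V -> V -> R[i]) (dom : set V) : Prop :=
  forall f, H f -> exists u : nat -> V, (forall n, dom (u n)) /\ hcvg dot u f.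

(* [(g, h)] is in the graph of the adjoint: [g] is in dom A* and A* g = h. *)
Definition adjoint_graph (R : realType) (V : lmodType R[i]) (H : set V)
    (dot : V -> V -> R[i]) (dom : set V) (A : V -> V) (g h : V) : Prop :=
  [/\ H g, H h & forall f, dom f -> dot (A f) g = dot f h].

Definition selfadjoint_operator (R : realType) (V : lmodType R[i]) (H : set V)
    (eqH : V -> V -> Prop) (dot : V -> V -> R[i]) (dom : set V) (A : V -> V)
    : Prop :=
  densely_defined H dot dom /\
  forall g h, H g -> H h ->
    (adjoint_graph H dot dom A g h <-> (dom g /\ eqH (A g) h)).

Definition cintegral (R : realType) (L : R) (u : R -> R[i]) : R[i] :=
  Complex (Rintegral (@lebesgue_measure R) `[0, L] (fun x => complex.Re (u x)))
          (Rintegral (@lebesgue_measure R) `[0, L] (fun x => complex.Im (u x))).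

Definition aeq (R : realType) (L : R) (u v : R -> R[i]) : Prop :=
  {ae (@lebesgue_measure R), forall x, `[0, L]%classic x -> u x = v x}.

Definition L2 (R : realType) (L : R) (u : R -> R[i]) : Prop :=
  [/\ measurable_fun `[0, L] (fun x => complex.Re (u x)),
      measurable_fun `[0, L] (fun x => complex.Im (u x)) &
      (@lebesgue_measure R).-integrable `[0, L]
        (fun x => (complex.Re (u x) ^+ 2 + complex.Im (u x) ^+ 2)%:E)].

(* Real-valued test functions of class C^1 with compact support in ]0, L[; they
   define the same weak derivatives as smooth ones, and are the test functions
   used by Brezis (Functional Analysis, Sobolev Spaces and PDE, chapter 8). *)
Definition test_function (R : realType) (L : R) (phi : R -> R) : Prop :=
  [/\ forall x, derivable phi x 1,
      continuous (derive1 phi) &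
      exists a b : R, [/\ 0 < a, b < L &
        forall x, phi x != 0 -> a <= x <= b]].

Definition weak_derivative (R : realType) (L : R) (u v : R -> R[i]) : Prop :=
  forall phi : R -> R, test_function L phi ->
    cintegral L (fun x => u x * (derive1 phi x)%:C%C) =
    - cintegral L (fun x => v x * (phi x)%:C%C).

Fixpoint sobolev (R : realType) (L : R) (k : nat) (u : R -> R[i]) : Prop :=
  match k with
  | 0 => L2 L u
  | k'.+1 => L2 L u /\ exists v, weak_derivative L u v /\ sobolev L k' v
  end.

(* A representative of the weak derivative of [u], which is unique up to
   almost everywhere equality; irrelevant when [u] has none in L^2. *)
Definition wD (R : realType) (L : R) (u : R -> R[i]) : R -> R[i] :=
  xget (fun=> 0) [set v | L2 L v /\ weak_derivative L u v].

Definition wDn (R : realType) (L : R) (k : nat) (u : R -> R[i]) : R -> R[i] :=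
  iter k (wD L) u.

(* The value at [x] of the continuous representative of [u] on [0, L]; this is
   the meaning of point values of (derivatives of) Sobolev functions. *)
Definition trace (R : realType) (L : R) (u : R -> R[i]) (x : R) : R[i] :=
  xget 0 [set c | exists v : R -> R[i],
    [/\ {within `[0, L], continuous (fun y => complex.Re (v y))},
        {within `[0, L], continuous (fun y => complex.Im (v y))},
        aeq L u v & v x = c]].

Definition state (R : realType) : lmodType R[i] :=
  ((R -> R[i]^o) * (R -> R[i]^o) * (R -> R[i]^o) * (R -> R[i]^o) * R[i]^o)%type.

Definition f0 (R : realType) (f : state R) : R -> R[i] := f.1.1.1.1.
Definition f1 (R : realType) (f : state R) : R -> R[i] := f.1.1.1.2.
Definition f2 (R : realType) (f : state R) : R -> R[i] := f.1.1.2.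
Definition f3 (R : realType) (f : state R) : R -> R[i] := f.1.2.
Definition f4 (R : realType) (f : state R) : R[i] := f.2.

Definition beam_space (R : realType) (L : R) : set (state R) :=
  [set f | [/\ sobolev L 2 (f0 f), L2 L (f1 f), sobolev L 1 (f2 f) &
               L2 L (f3 f)] /\
           [/\ trace L (f0 f) 0 = 0, trace L (wD L (f0 f)) 0 = 0 &
               trace L (f2 f) 0 = 0]].

Definition beam_eq (R : realType) (L : R) (f g : state R) : Prop :=
  [/\ aeq L (f0 f) (f0 g), aeq L (f1 f) (f1 g), aeq L (f2 f) (f2 g),
      aeq L (f3 f) (f3 g) & f4 f = f4 g].

Definition beam_dot (R : realType) (L m J S E G Cp : R) (f g : state R)
    : R[i] :=
  (2^-1)%:C%C * cintegral L (fun x =>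
      E%:C%C * wDn L 2 (f0 f) x * conjc (wDn L 2 (f0 g) x)
    + m%:C%C * f1 f x * conjc (f1 g x)
    + G%:C%C * wD L (f2 f) x * conjc (wD L (f2 g) x)
    + J%:C%C * f3 f x * conjc (f3 g x)
    + S%:C%C * (f1 f x * conjc (f3 g x) + f3 f x * conjc (f1 g x)))
  + (2^-1)%:C%C * Cp%:C%C * f4 f * conjc (f4 g).

(* [Res] is the constant usually written R, here the name of the real field. *)
Definition beam_op (R : realType) (L m J S E G Cp Res CD : R) (f : state R)
    : state R :=
  let D := m * J - S ^+ 2 in
  let i : R[i] := Complex 0 1 in
  (fun x => - i * f1 f x,
   fun x => i * (E * J / D)%:C%C * wDn L 4 (f0 f) x
          + i * (G * S / D)%:C%C * wDn L 2 (f2 f) x,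
   fun x => - i * f3 f x,
   fun x => - i * (E * S / D)%:C%C * wDn L 4 (f0 f) x
          - i * (G * m / D)%:C%C * wDn L 2 (f2 f) x,
   i * (CD / Cp)%:C%C * trace L (wD L (f1 f)) L
     + i * (1 / (Cp * Res))%:C%C * f4 f).

Definition beam_dom (R : realType) (L E G k1 k2 CI : R) : set (state R) :=
  [set f | [/\ beam_space L f,
     [/\ sobolev L 4 (f0 f), sobolev L 2 (f1 f), sobolev L 2 (f2 f) &
         sobolev L 1 (f3 f)],
     [/\ trace L (f1 f) 0 = 0, trace L (wD L (f1 f)) 0 = 0 &
         trace L (f3 f) 0 = 0] &
     [/\ trace L (wDn L 3 (f0 f)) L = 0,
         E%:C%C * trace L (wDn L 2 (f0 f)) L
           + k1%:C%C * trace L (wD L (f1 f)) L + CI%:C%C * f4 f = 0 &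
         G%:C%C * trace L (wD L (f2 f)) L
           + k2%:C%C * trace L (f3 f) L = 0]]].

(* Main.v *)
From mathcomp Require Import all_boot all_order all_algebra.
From mathcomp Require Import all_classical all_reals all_analysis.
From mathcomp Require Import measurable_realfun ring lra.
From mathcomp.real_closed Require Import complex.
Require Import Defs.
Set Implicit Arguments.
Unset Strict Implicit.
Unset Printing Implicit Defensive.
Import Order.TTheory GRing.Theory Num.Theory.
Import numFieldNormedType.Exports.
Local Open Scope classical_set_scope.
Local Open Scope ring_scope.

(** Everything rests on one characterization: for square integrable [u] and [v]
    on [0, L], [v] is the weak derivative of [u] if and only if [u] agrees almost
    everywhere with [c + \int_0^x v] for some constant [c] ([rweakP]).  One
    direction is integration by parts, obtained from the classical one by density
    of continuous functions in L^1; the other is the du Bois-Reymond lemma, proved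
    by testing against tent functions shrinking to Lebesgue points.  The constant
    and the derivative are unique, so [wD] is the derivative in this sense and
    [trace] evaluates [c + \int_0^x v]; from then on Sobolev spaces and boundary
    values are handled through the relation [primitive L u c v].

    Closedness.  If [u_n = c_n + \int v_n] with [u_n -> u] and [v_n -> v] in L^2,
    then the [c_n] converge and [u = c + \int v], with convergence of all point
    values ([primitive_closed]).  Since S < min(m, J), the energy norm controls the
    L^2 norms of [f0''], [f1], [f2'], [f3] and the modulus of [f4] ([coercive]).
    Suppose [u_n -> f] and [A u_n -> g] in this norm.  The second and fourth
    components of [A u_n] are combinations of the fourth derivative of the first
    component and of the second derivative of the third one with determinant
    E G / D <> 0, so both derivatives converge in L^2.  Integrating down from these
    highest derivatives, all lower derivatives and their boundary values converge:
    [f] satisfies the boundary conditions and [A f = g] ([beam_op_closed]).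

    Unboundedness.  On the states whose only nonzero component is
    [f3 = sin (n pi x / L)], the operator acts as [f3 |-> f2 = - i f3], and the
    energy norm of [f2] contains the derivative of [f2]; the quotient of the norms
    grows like [n] ([wave_norms]).

    Nonselfadjointness.  The static state [f = (a x^2, 0, 0, 0, 1)] with
    [2 a E + CI = 0] is in the domain and [A f = (0, 0, 0, 0, i / (Cp Res))], so
    that [<A f, f> = i / (2 Res)] is not real. *)

(** Lets [filterS] and its relatives apply to statements that hold almost
    everywhere for the Lebesgue measure. *)
#[local] Instance ae_lebesgue_filter (R : realType) :
  Filter (nbhs (almost_everywhere (@lebesgue_measure R))).
Proof. exact: (ae_filter_ringOfSetsType (@lebesgue_measure R)). Qed.

(** * Square integrable functions on [0, L] *)

Section SquareIntegrable.
Context {R : realType}.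
Notation mu := (@lebesgue_measure R).
Implicit Types (L x c : R) (u v w : R -> R).

Definition integ L u := mu.-integrable `[0, L] (EFin \o u).

Definition rint x u : R := \int[mu]_(t in `[0, x]) u t.

Definition rae L u v := {ae mu, forall x, `[0, L]%classic x -> u x = v x}.

Definition sqint L u :=
  measurable_fun `[0, L] u /\ integ L (fun x => u x ^+ 2).

Definition sqn L u : R := rint L (fun x => u x ^+ 2).

Lemma itv_lty L : (mu `[0%R, L]%classic < +oo)%E.
Proof. by rewrite lebesgue_measure_itv; case: ifPn => // _; rewrite -EFinB ltry. Qed.

Lemma integ_meas L u : integ L u -> measurable_fun `[0, L] u.
Proof. by move=> /measurable_int /measurable_EFinP. Qed.

Lemma integ_cst L c : integ L (fun=> c).
Proof.
apply: measurable_bounded_integrable => //; first exact: itv_lty.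
exact: bounded_cst.
Qed.

Lemma integ_le L u v : measurable_fun `[0, L] u ->
  (forall x, `[0, L]%classic x -> `|u x| <= v x) -> integ L v -> integ L u.
Proof.
move=> mu' uv; apply: le_integrable => //; first exact/measurable_EFinP.
by move=> x xL /=; rewrite lee_fin (le_trans (uv _ xL))// ler_norm.
Qed.

Lemma integD L u v : integ L u -> integ L v -> integ L (fun x => u x + v x).
Proof. by move=> iu iv; exact: (integrableD _ iu iv). Qed.

Lemma integZ L c u : integ L u -> integ L (fun x => c * u x).
Proof. by move=> iu; exact: (integrableZl _ c iu). Qed.

Lemma integN L u : integ L u -> integ L (fun x => - u x).
Proof. by move=> iu; exact: (integrableN iu). Qed.

Lemma integB L u v : integ L u -> integ L v -> integ L (fun x => u x - v x).
Proof. by move=> iu /integN iv; exact: integD. Qed.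

Lemma integS L x u : 0 <= x <= L -> integ L u -> integ x u.
Proof.
move=> /andP[x0 xL]; apply: integrableS => //.
by apply: subset_itvScc; rewrite bnd_simp.
Qed.

Lemma integ_cont L u : {within `[0, L], continuous u} -> integ L u.
Proof. by move=> cu; apply: continuous_compact_integrable => //; exact: segment_compact. Qed.

Lemma eq_rint x u v : (forall t, `[0, x]%classic t -> u t = v t) ->
  rint x u = rint x v.
Proof. by move=> uv; apply: eq_Rintegral => t /set_mem; exact: uv. Qed.

Lemma rintD x u v : integ x u -> integ x v ->
  rint x (fun t => u t + v t) = rint x u + rint x v.
Proof. exact: RintegralD. Qed.

Lemma rintB x u v : integ x u -> integ x v ->
  rint x (fun t => u t - v t) = rint x u - rint x v.
Proof. exact: RintegralB. Qed.

Lemma rintZ x c u : integ x u -> rint x (fun t => c * u t) = c * rint x u.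
Proof. by move=> iu; exact: RintegralZl. Qed.

Lemma rint_cst x c : 0 <= x -> rint x (fun=> c) = c * x.
Proof.
move=> x0; rewrite /rint Rintegral_cst//= lebesgue_measure_itv /= lte_fin.
case: ltP => [_|x0']; first by rewrite /= oppr0 addr0.
by have -> : x = 0 by apply/le_anti; rewrite x0 x0'.
Qed.

Lemma rint_ge0 x u : (forall t, 0 <= u t) -> 0 <= rint x u.
Proof. by move=> u0; exact: Rintegral_ge0. Qed.

Lemma rint_le x u v : integ x u -> integ x v ->
  (forall t, `[0, x]%classic t -> u t <= v t) -> rint x u <= rint x v.
Proof. exact: le_Rintegral. Qed.

Lemma rint_norm x u : integ x u -> `|rint x u| <= rint x (fun t => `|u t|).
Proof. by move=> iu; exact: le_normr_Rintegral. Qed.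

Lemma rint_zero x : rint x (fun=> 0) = 0.
Proof. by rewrite /rint /Rintegral integral0. Qed.

Lemma rint0 u : rint 0 u = 0.
Proof. by rewrite /rint set_itv1 Rintegral_set1. Qed.

Lemma integ_norm L u : integ L u -> integ L (fun t => `|u t|).
Proof. exact: integrable_norm. Qed.

Lemma rint_subset x L u : 0 <= x <= L -> integ L u -> (forall t, 0 <= u t) ->
  rint x u <= rint L u.
Proof.
move=> xL iu u0; have ix := integS xL iu.
rewrite /rint /Rintegral fine_le ?integrable_fin_num//.
apply: ge0_subset_integral => //; first exact: measurable_int iu.
  by move=> t _; rewrite lee_fin.
by case/andP: xL => x0 xL; apply: subset_itvScc; rewrite bnd_simp.
Qed.

Lemma raeS L x u v : x <= L -> rae L u v -> rae x u v.
Proof.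
move=> xL; apply: filterS => t; rewrite /= !in_itv/= => + /andP[t0 tx]; apply.
by rewrite t0 (le_trans tx).
Qed.

Lemma rae_sym L u v : rae L u v -> rae L v u.
Proof. by apply: filterS => t h tL; rewrite h. Qed.

Lemma rae_trans L u v w : rae L u v -> rae L v w -> rae L u w.
Proof. by apply: filterS2 => t h1 h2 tL; rewrite h1// h2. Qed.

Lemma eq_rae L u v : (forall x, `[0, L]%classic x -> u x = v x) -> rae L u v.
Proof. by move=> uv; exact: aeW. Qed.

Lemma rint_ae L u v : measurable_fun `[0, L] u -> measurable_fun `[0, L] v ->
  rae L u v -> rint L u = rint L v.
Proof.
move=> mu' mv uv; rewrite /rint /Rintegral; congr fine.
apply: ae_eq_integral => //; try exact/measurable_EFinP.
by apply: filterS uv => t h tL; rewrite h.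
Qed.

Lemma sqint_integ L u : sqint L u -> integ L u.
Proof.
move=> [mu' iu]; apply: (@integ_le _ _ (fun x => 1 + u x ^+ 2)) => //.
  move=> x _; rewrite ler_norml; apply/andP; split; nra.
by apply: integD => //; exact: integ_cst.
Qed.

Lemma sqint_mul L u v : sqint L u -> sqint L v -> integ L (fun x => u x * v x).
Proof.
move=> [mu' iu] [mv iv].
apply: (@integ_le _ _ (fun x => u x ^+ 2 + v x ^+ 2)) => //.
- exact: measurable_funM.
- move=> x _; rewrite ler_norml; apply/andP; split; nra.
- exact: integD.
Qed.

Lemma sqintD L u v : sqint L u -> sqint L v -> sqint L (fun x => u x + v x).
Proof.
move=> su sv; split; first by apply: measurable_funD; [exact: su.1|exact: sv.1].
have -> : (fun x => (u x + v x) ^+ 2) =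
    (fun x => (u x ^+ 2 + v x ^+ 2) + 2 * (u x * v x)).
  by apply/funext => x; ring.
apply: integD; first by apply: integD; [exact: su.2|exact: sv.2].
by apply: integZ; exact: sqint_mul.
Qed.

Lemma sqintZ L c u : sqint L u -> sqint L (fun x => c * u x).
Proof.
move=> [mu' iu]; split; first exact: measurable_funM.
have -> : (fun x => (c * u x) ^+ 2) = (fun x => c ^+ 2 * u x ^+ 2).
  by apply/funext => x; ring.
exact: integZ.
Qed.

Lemma sqintB L u v : sqint L u -> sqint L v -> sqint L (fun x => u x - v x).
Proof.
move=> su /(sqintZ (-1)) sv.
have -> : (fun x => u x - v x) = (fun x => u x + -1 * v x).
  by apply/funext => x; ring.
exact: sqintD.
Qed.

Lemma sqint_cont L u : {within `[0, L], continuous u} -> sqint L u.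
Proof.
move=> cu; split; first by apply: (@integ_meas L); exact: integ_cont.
apply: integ_cont; apply/subspace_continuousP => x xL.
rewrite (_ : (fun x => u x ^+ 2) = u \* u); last by apply/funext => t; rewrite expr2.
by move/subspace_continuousP : cu => /(_ x xL) cu; apply: cvgM.
Qed.

Lemma sqint_cst L c : sqint L (fun=> c).
Proof. by apply: sqint_cont; apply: continuous_subspaceT => x; exact: cvg_cst. Qed.

Lemma sqn_ge0 L u : 0 <= sqn L u.
Proof. by apply: rint_ge0 => t; exact: sqr_ge0. Qed.

Lemma sqnD_le L u v : sqint L u -> sqint L v ->
  sqn L (fun x => u x + v x) <= 2 * sqn L u + 2 * sqn L v.
Proof.
move=> su sv; rewrite /sqn -!rintZ; [|exact: sv.2|exact: su.2].
rewrite -rintD; [|by apply: integZ; exact: su.2|by apply: integZ; exact: sv.2].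
apply: rint_le; first exact: (sqintD su sv).2.
  by apply: integD; apply: integZ; [exact: su.2|exact: sv.2].
move=> t _ /=; have := sqr_ge0 (u t - v t); nra.
Qed.

Lemma sqnZ L c u : sqint L u -> sqn L (fun x => c * u x) = c ^+ 2 * sqn L u.
Proof.
move=> su; rewrite /sqn -rintZ; last exact: su.2.
by congr (rint _ _); apply/funext => x; ring.
Qed.

Lemma sqn_ae L u v : sqint L u -> sqint L v -> rae L u v -> sqn L u = sqn L v.
Proof.
move=> su sv uv; apply: rint_ae; [exact: integ_meas su.2|exact: integ_meas sv.2|].
by apply: filterS uv => t h tL; rewrite h.
Qed.

Lemma sqn0 L u : sqint L u -> sqn L u = 0 -> rae L u (fun=> 0).
Proof.
move=> su u0.
have : (\int[mu]_(t in `[0%R, L]) `|(u t ^+ 2)%:E| = 0)%E.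
  transitivity (\int[mu]_(t in `[0%R, L]) (u t ^+ 2)%:E)%E.
    by apply: eq_integral => t _; rewrite gee0_abs// lee_fin sqr_ge0.
  have /fineK <- : (\int[mu]_(t in `[0%R, L]) (u t ^+ 2)%:E)%E \is a fin_num.
    by apply: integrable_fin_num => //; exact: su.2.
  by congr EFin.
move/ae_eq_integral_abs => /(_ _)[]//; first exact: measurable_int su.2.
move=> N [mN N0 sN]; exists N; split => // t h; apply: sN => /= h'; apply: h => tL.
by have /= [/eqP] := h' tL; rewrite sqrf_eq0 => /eqP.
Qed.

(** The Cauchy-Schwarz inequality against a constant: [\int (u - t)^2 >= 0] at
    its minimum, where [t] is the mean of [u]. *)
Lemma rint_sqr_le L x u : 0 <= x <= L -> sqint L u ->
  rint x u ^+ 2 <= L * sqn L u.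
Proof.
move=> /andP[]; rewrite le_eqVlt => /predU1P[<- L0 _|x0 xL su].
  by rewrite rint0 expr0n/= mulr_ge0// sqn_ge0.
have xL' : 0 <= x <= L by rewrite ltW.
have iu : integ x u by apply: integS xL' _; exact: sqint_integ.
have iu2 : integ x (fun t => u t ^+ 2) by apply: integS xL' _; exact: su.2.
have h (t : R) : 0 <= rint x (fun y => u y ^+ 2) - 2 * t * rint x u + t ^+ 2 * x.
  rewrite -(rint_cst _ (ltW x0)) -!rintZ// -rintB//; last exact: integZ.
  rewrite -rintD; [|by apply: integB => //; exact: integZ|exact: integ_cst].
  apply: rint_ge0 => y; have := sqr_ge0 (u y - t); nra.
have := h (rint x u / x); have := rint_subset xL' su.2 (fun t => sqr_ge0 (u t)).
rewrite -/(sqn L u); set a := rint x u; set b := rint x _ => ba.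
have -> : b - 2 * (a / x) * a + (a / x) ^+ 2 * x = b - a ^+ 2 / x.
  by field; rewrite gt_eqF.
rewrite subr_ge0 ler_pdivrMr// => ab.
have := sqn_ge0 L u; nra.
Qed.

End SquareIntegrable.

(** * Primitives and integration by parts against test functions *)

Section Primitives.
Context {R : realType}.
Notation mu := (@lebesgue_measure R).
Implicit Types (L x c : R) (u v w : R -> R).

Lemma prim_cont L v : 0 <= L -> integ L v ->
  {within `[0, L], continuous (fun x => rint x v)}.
Proof. exact: parameterized_integral_continuous. Qed.

Lemma prim_sqint L v c : 0 <= L -> integ L v -> sqint L (fun x => c + rint x v).
Proof.
by move=> L0 iv; apply: sqintD; [exact: sqint_cst|exact/sqint_cont/prim_cont].
Qed.

Lemma cont_bounded L u : {within `[0, L], continuous u} ->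
  exists2 M : R, 0 <= M & forall x, `[0, L]%classic x -> `|u x| <= M.
Proof.
move=> cu.
have /compact_bounded[M [_ mrt]] := continuous_compact cu (@segment_compact _ 0 L).
exists (`|M| + 1); first by rewrite addr_ge0.
by move=> x xL; apply: mrt => //; rewrite ltr_pwDr// ler_norm.
Qed.

Lemma ae_neq (a : R) : {ae mu, forall x, x <> a}.
Proof.
exists [set a]; split => //; first exact: lebesgue_measure_set1.
by move=> x /=; rewrite not_notE.
Qed.

Lemma rae_open L u v : {ae mu, forall x, 0 < x < L -> u x = v x} -> rae L u v.
Proof.
apply: filterS3 (ae_neq 0) (ae_neq L) => x /eqP x0 /eqP xL h.
rewrite /= in_itv/= => /andP[x0' xL']; apply: h.
by rewrite !lt_neqAle x0' xL' xL eq_sym x0.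
Qed.

(** A nonempty relatively open subset of [0, L] contains an interval and thus has
    positive measure.  This is what makes the continuous representative behind
    [trace] unique. *)
Lemma cont_rae_eq L u v : 0 < L -> {within `[0, L], continuous u} ->
  {within `[0, L], continuous v} -> rae L u v ->
  forall x, 0 <= x <= L -> u x = v x.
Proof.
move=> L0 cu cv [N [mN N0 sN]] x xL; apply/eqP/negP => /negP uvx.
have xI : `[0, L]%classic x by rewrite /= in_itv.
have : \forall y \near within `[0, L]%classic (nbhs x), u y - v y != 0.
  move/subspace_continuousP : cu => /(_ x xI) cu.
  move/subspace_continuousP : cv => /(_ x xI) cv.
  have : u y - v y @[y --> within `[0, L]%classic (nbhs x)] --> u x - v x.
    exact: cvgB.
  by move=> /cvgr_neq0; apply; rewrite subr_eq0.
rewrite near_withinE => -[e /= e0 he].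
pose lo := Num.max 0 (x - e); pose hi := Num.min L (x + e).
have : (mu `]lo, hi[%classic <= mu N)%E.
  apply: le_measure; rewrite ?inE//.
  move=> y /=; rewrite in_itv/= /lo /hi gt_max lt_min => /andP[/andP[y0 y1] /andP[y2 y3]].
  apply: sN => /= h.
  have yI : `[0, L]%classic y by rewrite /= in_itv/= !ltW.
  have /he : ball x e y by rewrite /ball/= ltr_distlC y1.
  by move=> /(_ yI)/negP; apply; rewrite subr_eq0 h.
rewrite N0 lebesgue_measure_itv/= lte_fin.
have xx : lo < hi.
  case/andP: xL => x0 xL; rewrite /lo /hi.
  by rewrite gt_max !lt_min L0 /=; apply/andP; split; [|apply/andP; split]; lra.
by rewrite xx -EFinD lee_fin leNgt subr_gt0 xx.
Qed.

(** By the Lebesgue differentiation theorem a function is almost everywhere the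
    derivative of its primitive. *)
Lemma prim_inj L w : 0 < L -> integ L w -> (forall x, 0 <= x <= L -> rint x w = 0) ->
  rae L w (fun=> 0).
Proof.
move=> L0 iw w0; apply: rae_open.
have iT : mu.-integrable setT (EFin \o (w \_ `[0, L])).
  by rewrite -restrict_EFin; apply/integrable_restrict => //=; rewrite setTI.
have := @FTC1 R (w \_ `[0, L]) (BLeft 0) _ (integrable_locally _ iw).
move=> /(_ _)[]//.
  by move=> y; apply: integrableS iT.
move=> N [mN N0 sN]; exists N; split => // x h; apply: sN => /= h'; apply: h => /andP[x0 xL].
case: h' => [|_]; first by rewrite lte_fin.
rewrite patchE mem_set ?/= ?in_itv/= ?ltW// => <-.
rewrite derive1E (@near_eq_derive _ _ _ _ (cst 0) x 1) ?derive_cst//.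
near=> y.
have y0 : 0 < y by near: y; exact: lt_nbhsr.
have yL : y < L by near: y; exact: lt_nbhsl.
rewrite /= -[RHS](w0 y) ?ltW//.
apply: eq_Rintegral => t; rewrite inE/= in_itv/= => /andP[t0 ty].
by rewrite patchE mem_set//= in_itv/= t0 (le_trans ty) ?ltW.
Unshelve. all: by end_near. Qed.

Lemma test_cont L phi : test_function L phi -> continuous phi.
Proof.
case=> dphi _ _ x; apply: differentiable_continuous.
exact/derivable1_diffP.
Qed.

Lemma test_bnd L phi : test_function L phi -> phi 0 = 0 /\ phi L = 0.
Proof.
move=> [_ _ [a [b [a0 bL h]]]]; split; apply/eqP; apply: contraT => /h /andP[h1 h2].
  by move: (le_lt_trans h1 a0); rewrite ltxx.
by move: (lt_le_trans bL h2); rewrite ltxx.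
Qed.

Lemma ibp_cont L g phi : 0 < L -> continuous g -> test_function L phi ->
  rint L (fun x => rint x g * derive1 phi x) = - rint L (fun x => g x * phi x).
Proof.
move=> L0 cg tphi; have [phi0 phiL] := test_bnd tphi.
have cphi := test_cont tphi; case: tphi => dphi cdphi _.
have ig y : integ y g by apply/integ_cont/continuous_subspaceT.
rewrite /rint (@Rintegration_by_parts R (fun x => rint x g) phi g (derive1 phi))//.
- by rewrite phi0 phiL !mulr0 subr0 sub0r.
- exact: continuous_subspaceT.
- have := prim_cont (ltW L0) (ig L) => /(continuous_within_itvP _ L0)[_ ? ?].
  split => // x; rewrite in_itv/= => /andP[x0 xL].
  have [] := @continuous_FTC1 R g (BLeft 0) x (x + 1) _ (ig _) _ (cg x) => //.
  by rewrite ltrDl.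
- move=> x; rewrite in_itv/= => /andP[x0 xL].
  have [] := @continuous_FTC1 R g (BLeft 0) x (x + 1) _ (ig _) _ (cg x) => //.
  by rewrite ltrDl.
- exact: continuous_subspaceT.
- split; [by move=> x _; exact: dphi| |].
    by apply: cvg_at_right_filter; exact: cphi.
  by apply: cvg_at_left_filter; exact: cphi.
Qed.

Lemma integM_cont L u v : integ L u -> {within `[0, L], continuous v} ->
  integ L (fun x => u x * v x).
Proof.
move=> iu cv; have [M M0 vM] := cont_bounded cv.
apply: (@integ_le _ _ _ (fun x => M * `|u x|)).
- by apply: measurable_funM; apply: integ_meas => //; exact: integ_cont.
- by move=> x xL; rewrite normrM mulrC ler_wpM2r// vM.
- exact/integZ/integ_norm.
Qed.

(** Both sides are continuous in [v] for the L^1 norm, since [phi] and its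
    derivative are bounded; the case of continuous [v] is classical. *)
Lemma ibp_test L v phi : 0 < L -> integ L v -> test_function L phi ->
  rint L (fun x => rint x v * derive1 phi x) = - rint L (fun x => v x * phi x).
Proof.
move=> L0 iv tphi.
have cphi : {within `[0, L], continuous phi}.
  exact/continuous_subspaceT/(test_cont tphi).
have cdphi : {within `[0, L], continuous (derive1 phi)}.
  by apply: continuous_subspaceT; case: tphi.
have [M M0 phiM] := cont_bounded cphi.
have [K K0 dphiK] := cont_bounded cdphi.
apply/eqP; rewrite -subr_eq0 opprK -normr_le0; apply/ler_addgt0Pr => e e0; rewrite add0r.
have [g_ [cg _ gv]] :=
  approximation_continuous_integrable (measurable_itv _) (itv_lty L) iv.
pose d := e / (K * L + M + 1).
have C0 : 0 < K * L + M + 1 by rewrite ltr_wpDl// addr_ge0// mulr_ge0// ltW.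
have d0 : 0 < d by rewrite divr_gt0.
have [n gn] : exists n, rint L (fun x => `|v x - g_ n x|) <= d.
  move/fine_cvgP : gv => [_ /cvgrPdist_le/(_ d d0)[n _ /(_ n (leqnn n)) h]].
  exists n; move: h; rewrite sub0r normrN /= => h.
  by apply: le_trans h; exact: ler_norm.
have ig : integ L (g_ n) by apply/integ_cont/continuous_subspaceT/cg.
have ibpg := ibp_cont L0 (cg n) tphi.
set w := fun x => v x - g_ n x.
have iw : integ L w by exact: integB.
have cP u : integ L u -> integ L (fun x => rint x u * derive1 phi x).
  by move=> iu; apply: integM_cont => //; apply/integ_cont/prim_cont => //; exact: ltW.
have -> : rint L (fun x => rint x v * derive1 phi x) + rint L (fun x => v x * phi x) =
    rint L (fun x => rint x w * derive1 phi x) + rint L (fun x => w x * phi x).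
  have -> : rint L (fun x => rint x w * derive1 phi x) =
      rint L (fun x => rint x v * derive1 phi x - rint x (g_ n) * derive1 phi x).
    apply: eq_Rintegral => x; rewrite inE/= in_itv/= => xL.
    by rewrite rintB ?mulrBl//; exact: integS xL _.
  have -> : rint L (fun x => w x * phi x) =
      rint L (fun x => v x * phi x - g_ n x * phi x).
    by apply: eq_Rintegral => x _; rewrite mulrBl.
  by rewrite !rintB ?ibpg//; [ring|exact: integM_cont|exact: integM_cont|exact: cP|exact: cP].
rewrite (le_trans (ler_normD _ _))//.
have h1 : `|rint L (fun x => rint x w * derive1 phi x)| <= K * d * L.
  rewrite -(rint_cst _ (ltW L0)); apply: le_trans (rint_norm (cP _ iw)) _.
  apply: rint_le; [exact/integ_norm/cP|exact: integ_cst|] => t tL.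
  rewrite normrM mulrC ler_pM ?dphiK//; move: tL; rewrite /= in_itv/= => tL.
  apply: le_trans (rint_norm (integS tL iw)) _.
  by apply: le_trans (rint_subset tL (integ_norm iw) (fun=> normr_ge0 _)) _.
have h2 : `|rint L (fun x => w x * phi x)| <= M * d.
  have iwp : integ L (fun x => w x * phi x) by exact: integM_cont.
  apply: le_trans (rint_norm iwp) _; apply: le_trans (_ : _ <= M * rint L (fun x => `|w x|)) _.
    rewrite -rintZ; last exact: integ_norm.
    apply: rint_le; [exact: integ_norm|exact/integZ/integ_norm|] => t tL.
    by rewrite normrM mulrC ler_wpM2r// phiM.
  by rewrite ler_wpM2l.
have -> : e = d * (K * L + M + 1) by rewrite /d mulfVK// gt_eqF.
nra.
Qed.

End Primitives.

(** * The du Bois-Reymond lemma *)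

Section DuBoisReymond.
Context {R : realType}.
Notation mu := (@lebesgue_measure R).
Implicit Types (L x c a b h : R) (u v w : R -> R).

Definition pospart (t : R) : R := (t + `|t|) / 2.

(** The tent of mass one on [a - h, a + h], and below its antiderivative, a C^1
    quadratic spline going from 0 to 1: second differences of the positive part
    and of half its square. *)
Definition hat a h x : R :=
  (pospart (x - a + h) - 2 * pospart (x - a) + pospart (x - a - h)) / h ^+ 2.

Definition ramp a h x : R :=
  (pospart (x - a + h) ^+ 2 - 2 * pospart (x - a) ^+ 2
   + pospart (x - a - h) ^+ 2) / (2 * h ^+ 2).

Lemma pospart_ge t : 0 <= t -> pospart t = t.
Proof. by move=> t0; rewrite /pospart ger0_norm//; field. Qed.

Lemma pospart_le t : t <= 0 -> pospart t = 0.
Proof. by move=> t0; rewrite /pospart ler0_norm// subrr mul0r. Qed.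

Lemma pospart_cont : continuous pospart.
Proof.
move=> t; apply: cvgMl => //; apply: cvgD; first exact: cvg_id.
exact: norm_continuous.
Qed.

Lemma hat_cont a h : continuous (hat a h).
Proof.
have pc (f : R -> R) t : {for t, continuous f} -> pospart (f y) @[y --> t] --> pospart (f t).
  by move=> cf; apply: (continuous_comp cf); exact: pospart_cont.
have sc (b : R) t : (x - a + b) @[x --> t] --> (t - a + b).
  by apply: cvgD; [apply: cvgB; [exact: cvg_id|exact: cvg_cst]|exact: cvg_cst].
have sc0 t : (x - a) @[x --> t] --> (t - a).
  by apply: cvgB; [exact: cvg_id|exact: cvg_cst].
move=> t; apply: cvgMl; apply: cvgD; last exact: pc (sc (- h) t).
apply: cvgB; first exact: pc (sc h t).
by apply: cvgMr; exact: pc (sc0 t).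
Qed.

Lemma hat_ge0 a h x : 0 < h -> 0 <= hat a h x.
Proof.
move=> h0; apply: divr_ge0; last exact: sqr_ge0.
have [h1|h1] := leP 0 (x - a + h); have [h2|h2] := leP 0 (x - a);
  have [h3|h3] := leP 0 (x - a - h);
  do ?[rewrite pospart_ge; last by [lra|exact: ltW]];
  do ?[rewrite pospart_le; last by [lra|exact: ltW]]; lra.
Qed.

Lemma hat_le a h x : 0 < h -> hat a h x <= h^-1.
Proof.
move=> h0; rewrite /hat ler_pdivrMr ?exprn_gt0// expr2 mulKf ?gt_eqF//.
have [h1|h1] := leP 0 (x - a + h); have [h2|h2] := leP 0 (x - a);
  have [h3|h3] := leP 0 (x - a - h);
  do ?[rewrite pospart_ge; last by [lra|exact: ltW]];
  do ?[rewrite pospart_le; last by [lra|exact: ltW]]; lra.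
Qed.

Lemma hat_out a h x : 0 < h -> h <= `|x - a| -> hat a h x = 0.
Proof.
move=> h0; rewrite ler_normr => /orP[h1|h1]; rewrite /hat.
  rewrite !pospart_ge; [ring|lra|lra|lra].
rewrite !pospart_le; [ring|lra|lra|lra].
Qed.

Lemma ramp_left a h x : 0 < h -> x <= a - h -> ramp a h x = 0.
Proof. by move=> h0 xa; rewrite /ramp !pospart_le; [ring|lra|lra|lra]. Qed.

Lemma ramp_right a h x : 0 < h -> a + h <= x -> ramp a h x = 1.
Proof.
move=> h0 xa; rewrite /ramp !pospart_ge; [field|lra|lra|lra].
by rewrite gt_eqF.
Qed.

(** The second-order remainder of the square of the positive part, whose derivative
    [2 * pospart] is 2-Lipschitz.  With [is_derive_quad] it gives the derivative
    without a case distinction at the kink. *)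
Lemma pospart_rem t k :
  `|pospart (t + k) ^+ 2 - pospart t ^+ 2 - 2 * pospart t * k| <= k ^+ 2.
Proof.
rewrite ler_norml; have [h1|h1] := leP 0 t; have [h2|h2] := leP 0 (t + k);
  rewrite ?(pospart_ge h1) ?(pospart_le (ltW h1)) ?(pospart_ge h2)
    ?(pospart_le (ltW h2)).
- by apply/andP; split; nra.
- have : 0 <= t * - (t + k) by rewrite mulr_ge0// oppr_ge0 ltW.
  have : 0 <= t * - k by rewrite mulr_ge0// oppr_ge0; lra.
  have := sqr_ge0 (t + k).
  by move=> *; apply/andP; split; nra.
- have : 0 <= - t * (t + k) by rewrite mulr_ge0// oppr_ge0 ltW.
  have : 0 <= - t * k by rewrite mulr_ge0//; lra.
  have := sqr_ge0 (t + k).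
  by move=> *; apply/andP; split; nra.
- by apply/andP; split; nra.
Qed.

Lemma is_derive_quad (f : R -> R) (x l C : R) :
  (forall k, `|f (x + k) - f x - l * k| <= C * k ^+ 2) -> is_derive x 1 f l.
Proof.
move=> fl.
have C0 : 0 <= C by have := fl 1; rewrite expr1n [C * 1]mulr1; exact: le_trans.
have cf : k^-1 *: (f (k *: 1 + x) - f x) @[k --> 0^'] --> l.
  apply/cvgrPdist_le => e e0.
  near=> k.
  have k0 : k != 0 by near: k; exact: nbhs_dnbhs_neq.
  have ke : `|k| <= e / (C + 1).
    by near: k; apply: dnbhs0_le; rewrite divr_gt0// ltr_wpDl.
  rewrite distrC -(ler_pM2r (_ : 0 < `|k|)) ?normr_gt0// -normrM.
  have -> : (k^-1 *: (f (k *: 1 + x) - f x) - l) * k = f (x + k) - f x - l * k.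
    by rewrite /GRing.scale/= mulr1 (addrC k); field.
  apply: le_trans (fl k) _; rewrite -(real_normK (num_real k)) expr2 mulrA ler_wpM2r//.
  apply: le_trans (ler_wpM2l C0 ke) _.
  rewrite mulrA ler_pdivrMr ?ltr_wpDl//; nra.
split; first by apply/cvg_ex; exists l.
by rewrite /derive; apply: cvg_lim.
Unshelve. all: by end_near. Qed.

Lemma ramp_derive a h x : 0 < h -> is_derive x 1 (ramp a h) (hat a h x).
Proof.
move=> h0; apply: (@is_derive_quad _ _ _ (2 / h ^+ 2)) => k.
have r1 := pospart_rem (x - a + h) k; have r2 := pospart_rem (x - a) k.
have r3 := pospart_rem (x - a - h) k.
have e1 : x + k - a + h = x - a + h + k by ring.
have e2 : x + k - a = x - a + k by ring.
have e3 : x + k - a - h = x - a - h + k by ring.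
move: r1 r2 r3; rewrite /ramp /hat e1 e3 e2.
set A1 := pospart (_ + k); set A0 := pospart (_ + h).
set B1 := pospart (_ + k); set B0 := pospart (x - a).
set C1 := pospart (_ + k); set C0 := pospart (_ - h).
rewrite !ler_norml => /andP[? ?] /andP[? ?] /andP[? ?].
have h2 : 0 < h ^+ 2 by rewrite exprn_gt0.
have -> : (A1 ^+ 2 - 2 * B1 ^+ 2 + C1 ^+ 2) / (2 * h ^+ 2) -
    (A0 ^+ 2 - 2 * B0 ^+ 2 + C0 ^+ 2) / (2 * h ^+ 2) -
    (A0 - 2 * B0 + C0) / h ^+ 2 * k =
  ((A1 ^+ 2 - A0 ^+ 2 - 2 * A0 * k) - 2 * (B1 ^+ 2 - B0 ^+ 2 - 2 * B0 * k)
   + (C1 ^+ 2 - C0 ^+ 2 - 2 * C0 * k)) / (2 * h ^+ 2).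
  by field; rewrite gt_eqF.
have -> : 2 / h ^+ 2 * k ^+ 2 = 4 * k ^+ 2 / (2 * h ^+ 2).
  by field; rewrite gt_eqF.
rewrite -mulNr ler_pdivlMr ?ler_pdivrMr ?mulfVK ?gt_eqF ?mulr_gt0//.
by apply/andP; split; lra.
Qed.

Lemma hat_int L a h : 0 < h -> 0 < a - h -> a + h < L -> rint L (hat a h) = 1.
Proof.
move=> h0 ah aL; have L0 : 0 < L by lra.
have dr x : derivable (ramp a h) x 1.
  by have := ramp_derive a x h0 => -[].
have cr x : {for x, continuous (ramp a h)}.
  by apply: differentiable_continuous; exact/derivable1_diffP.
rewrite /rint /Rintegral (@continuous_FTC2 R (hat a h) (ramp a h))//.
- rewrite ramp_right ?ramp_left//=; [by rewrite oppr0 addr0|lra|lra].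
- apply: continuous_subspaceT; exact: hat_cont.
- split; first by move=> x _; exact: dr.
    by apply: cvg_at_right_filter; exact: cr.
  by apply: cvg_at_left_filter; exact: cr.
- by move=> x _; rewrite derive1E; have := ramp_derive a x h0 => -[].
Qed.

(** A single ramp stays equal to 1 on its right; the difference of two has compact
    support, so that tents at different points are the same up to the derivative
    of a test function. *)
Lemma ramp_diff_test L a b h : 0 < h -> h < a < L - h -> h < b < L - h ->
  test_function L (fun x => ramp a h x - ramp b h x) /\
  forall x, derive1 (fun x => ramp a h x - ramp b h x) x = hat a h x - hat b h x.
Proof.
move=> h0 /andP[ha aL] /andP[hb bL].
have dr x : is_derive x 1 (fun x => ramp a h x - ramp b h x) (hat a h x - hat b h x).
  by apply: is_deriveB; exact: ramp_derive.
have dE x : derive1 (fun x => ramp a h x - ramp b h x) x = hat a h x - hat b h x.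
  by rewrite derive1E; case: (dr x).
split => //; split.
- by move=> x; case: (dr x).
- rewrite (funext dE) => x; apply: cvgB; exact: hat_cont.
- exists (Num.min a b - h), (Num.max a b + h); split.
  + by rewrite subr_gt0 lt_min ha.
  + by rewrite -ltrBrDr gt_max aL.
  + move=> x; apply: contraNT; rewrite negb_and -!ltNge => /orP[].
      rewrite ltrBrDr lt_min => /andP[? ?].
      by rewrite !ramp_left ?subrr//; lra.
    rewrite -ltrBrDr gt_max => /andP[? ?].
    by rewrite !ramp_right ?subrr//; lra.
Qed.

(** The tent is at most [1 / h] and lives on a ball of measure [2 h], so the error
    is at most twice the mean oscillation of [w] around [w a] on this ball. *)
Lemma hat_lebesgue L w a : integ L w -> 0 < a < L ->
  lebesgue_pt (w \_ `[0, L]) a ->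
  forall e : R, 0 < e ->
  \forall h \near 0^'+, `|rint L (fun x => w x * hat a h x) - w a| <= e.
Proof.
move=> iw /andP[a0 aL] law e e0.
have wa : (w \_ `[0, L]) a = w a by rewrite patchE mem_set//= in_itv/= !ltW.
pose f := w \_ `[0, L]; rewrite -/f in wa law.
have e2 : 0 < e / 2 by rewrite divr_gt0.
have [fd /cvgrPdist_le/(_ _ e2) hd] := (fine_cvgP _ _).1 law.
near=> h.
have h0 : 0 < h by [].
have ha : h < a by near: h; exact: nbhs_right_lt.
have hL : h < L - a by near: h; apply: nbhs_right_lt; rewrite subr_gt0.
have dh : (davg f a h <= (e / 2)%:E)%E.
  have dfin : davg f a h \is a fin_num by near: h; exact: fd.
  rewrite -(fineK dfin) lee_fin.
  have : `|0 - fine (davg f a h)| <= e / 2 by near: h; exact: hd.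
  by rewrite sub0r normrN; apply: le_trans; exact: ler_norm.
have ihat : {within `[0, L], continuous (hat a h)}.
  by apply: continuous_subspaceT; exact: hat_cont.
have iB : integ L (fun x => w x - w a) by apply: integB => //; exact: integ_cst.
have iwh : integ L (fun x => (w x - w a) * hat a h x) by exact: integM_cont.
have -> : rint L (fun x => w x * hat a h x) - w a =
    rint L (fun x => (w x - w a) * hat a h x).
  rewrite -[X in _ - X]mulr1 -(@hat_int L a h)//; [|lra|lra].
  rewrite -rintZ; last exact: integ_cont.
  rewrite -rintB; [|exact: integM_cont|apply: integZ; exact: integ_cont].
  by congr (rint _ _); apply/funext => x; ring.
apply: le_trans (rint_norm iwh) _.
rewrite -lee_fin /rint /Rintegral fineK; last first.
  by apply: integrable_fin_num => //; exact: integ_norm.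
have bL : ball a h `<=` `[0, L]%classic.
  move=> y; rewrite /ball/= ltr_distlC in_itv/= => /andP[? ?].
  by apply/andP; split; lra.
have mf0 : measurable_fun (ball a h) (fun y => `|f y - f a|).
  apply: measurableT_comp => //; apply: measurable_funB => //.
  apply: measurable_funS (_ : measurable_fun setT f) => //.
  by apply/(measurable_restrictT _ _).1 => //; exact: integ_meas.
have mfb : measurable_fun (ball a h) (fun y => h^-1 * `|f y - f a|).
  exact: measurable_funM.
pose g y := (h^-1 * `|f y - f a|)%:E.
have le1 : (\int[mu]_(y in `[0%R, L]) `|(w y - w a) * hat a h y|%:E <=
    \int[mu]_(y in `[0%R, L]) (g \_ (ball a h)) y)%E.
  apply: ge0_le_integral => //.
  - by apply/measurable_EFinP; apply: integ_meas; exact: integ_norm.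
  - apply/measurable_restrict => //; first exact: measurable_ball.
    by rewrite setIidr//; apply/measurable_EFinP.
  - move=> y yL; rewrite patchE; case: ifPn => yb.
      have wy : f y = w y by rewrite /f patchE mem_set.
      rewrite lee_fin normrM mulrC -wy -wa ler_wpM2r//.
      by rewrite ger0_norm ?hat_le// hat_ge0.
    rewrite hat_out ?mulr0 ?normr0//.
    move: yb; rewrite notin_setE /ball/= => /negP; rewrite -leNgt.
    by rewrite distrC.
apply: le_trans le1 _.
rewrite -integral_mkcondr setIidr// /g.
under eq_integral do rewrite EFinM.
rewrite ge0_integralZl//=; last 3 first.
  - exact: measurable_ball.
  - exact/measurable_EFinP.
  - by rewrite lee_fin invr_ge0 ltW.
move: dh; rewrite /davg /iavg (lebesgue_measure_ball _ (ltW h0)).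
rewrite inver mulrn_eq0/= gt_eqF// lee_pdivrMl ?mulrn_wgt0// => dh.
rewrite lee_pdivrMl//; apply: le_trans dh _.
by rewrite -EFinM lee_fin -mulr_natr; nra.
Unshelve. all: by end_near. Qed.

(** The tents at any two Lebesgue points [a] and [b] have the same integral
    against [w] as soon as [h] is small; letting [h] tend to 0, [w a = w b]. *)
Lemma weak0_const L w : 0 < L -> integ L w ->
  (forall phi, test_function L phi -> rint L (fun x => w x * derive1 phi x) = 0) ->
  exists c, rae L w (fun=> c).
Proof.
move=> L0 iw wphi.
have := lebesgue_differentiation (integrable_locally (measurable_itv _) iw).
move=> aew.
have [b bI lb] : exists2 b, 0 < b < L & lebesgue_pt (w \_ `[0, L]) b.
  apply: contrapT => h; case: aew => N [mN N0 sN].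
  have : (mu `]0%R, L[%classic <= mu N)%E.
    apply: le_measure; rewrite ?inE// => x; rewrite /= in_itv/= => xL.
    by apply: sN => /= lx; apply: h; exists x.
  by rewrite N0 lebesgue_measure_itv/= lte_fin L0 -EFinD lee_fin leNgt subr_gt0 L0.
exists (w b); apply: rae_open.
suff h a : lebesgue_pt (w \_ `[0, L]) a -> 0 < a < L -> w a = w b.
  by apply: filterS aew => a; exact: h.
move=> la aI.
apply/eqP; rewrite -subr_eq0 -normr_le0; apply/ler_addgt0Pr => e e0; rewrite add0r.
have e2 : 0 < e / 2 by rewrite divr_gt0.
have [/andP[a0 aL] /andP[b0 bL]] := (aI, bI).
near (0:R)^'+ => h.
have h0 : 0 < h by [].
have ha : h < a by near: h; exact: nbhs_right_lt.
have hb : h < b by near: h; exact: nbhs_right_lt.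
have haL : h < L - a by near: h; apply: nbhs_right_lt; rewrite subr_gt0.
have hbL : h < L - b by near: h; apply: nbhs_right_lt; rewrite subr_gt0.
have ea : `|rint L (fun x => w x * hat a h x) - w a| <= e / 2.
  by near: h; exact: hat_lebesgue iw aI la _ e2.
have eb : `|rint L (fun x => w x * hat b h x) - w b| <= e / 2.
  by near: h; exact: hat_lebesgue iw bI lb _ e2.
have [||tphi dphi] := @ramp_diff_test L a b h h0.
  by rewrite ha /=; lra.
  by rewrite hb /=; lra.
have iwh c : integ L (fun x => w x * hat c h x).
  by apply: integM_cont => //; apply: continuous_subspaceT; exact: hat_cont.
have := wphi _ tphi.
rewrite (@eq_rint _ L _ (fun x => w x * hat a h x - w x * hat b h x)); last first.
  by move=> x _; rewrite dphi mulrBr.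
rewrite rintB// => /subr0_eq ab.
by move: ea eb; rewrite ab !ler_norml => /andP[? ?] /andP[? ?]; apply/andP; split; lra.
Unshelve. all: by end_near. Qed.

Definition rweak L u v := forall phi, test_function L phi ->
  rint L (fun x => u x * derive1 phi x) = - rint L (fun x => v x * phi x).

Lemma rweak_prim L u v c : 0 < L -> sqint L u -> sqint L v ->
  rae L u (fun x => c + rint x v) -> rweak L u v.
Proof.
move=> L0 su sv uv phi tphi; have iv := sqint_integ sv.
have cdphi : {within `[0, L], continuous (derive1 phi)}.
  by apply: continuous_subspaceT; case: tphi.
have iP := integ_cont (prim_cont (ltW L0) iv).
transitivity (rint L (fun x => c * derive1 phi x + rint x v * derive1 phi x)).
  apply: rint_ae.
  - by apply: integ_meas; exact: (integM_cont (sqint_integ su)).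
  - by apply: integ_meas; apply: integD; [by apply: integZ; exact: integ_cont|exact: integM_cont].
  - by apply: filterS uv => x h xL; rewrite h// mulrDl.
rewrite rintD; [|by apply: integZ; exact: integ_cont|exact: integM_cont].
rewrite rintZ; last exact: integ_cont.
have -> : rint L (derive1 phi) = 0.
  have [phi0 phiL] := test_bnd tphi; have cphi := test_cont tphi.
  rewrite /rint /Rintegral (@continuous_FTC2 R _ phi)//; last first.
    split; first by case: tphi => + _ _ x _; exact.
      by apply: cvg_at_right_filter; exact: cphi.
    by apply: cvg_at_left_filter; exact: cphi.
  by rewrite /= phi0 phiL oppr0 addr0.
by rewrite mulr0 add0r ibp_test.
Qed.

(** For the direct implication, [u] minus the primitive of [v] has weak derivative
    zero. *)
Lemma rweakP L u v : 0 < L -> sqint L u -> sqint L v ->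
  rweak L u v <-> exists c, rae L u (fun x => c + rint x v).
Proof.
move=> L0 su sv; split=> [uv|[c]]; last exact: rweak_prim.
have iv := sqint_integ sv; have iu := sqint_integ su.
have cP := prim_cont (ltW L0) iv.
have [|phi tphi|c h] := @weak0_const L (fun x => u x - rint x v) L0.
- by apply: integB => //; exact: integ_cont.
- have cdphi : {within `[0, L], continuous (derive1 phi)}.
    by apply: continuous_subspaceT; case: tphi.
  rewrite (@eq_rint _ L _ (fun x => u x * derive1 phi x - rint x v * derive1 phi x));
    last by move=> x _; rewrite mulrBl.
  rewrite rintB; [|exact: integM_cont|by apply: integM_cont => //; exact: integ_cont].
  by rewrite uv// ibp_test// subrr.
- by exists c; apply: filterS h => x h xL; rewrite -(h xL) subrK.
Qed.

(** Both primitives are continuous, hence equal everywhere: their values at 0 give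
    the constants, and [prim_inj] the densities. *)
Lemma prim_uniq L c c' v v' : 0 < L -> integ L v -> integ L v' ->
  rae L (fun x => c + rint x v) (fun x => c' + rint x v') ->
  c = c' /\ rae L v v'.
Proof.
move=> L0 iv iv' h.
have cc (d : R) z : integ L z -> {within `[0, L], continuous (fun x => d + rint x z)}.
  move=> iz; apply/subspace_continuousP => x xL; apply: cvgD; first exact: cvg_cst.
  by have /subspace_continuousP := prim_cont (ltW L0) iz; exact.
have {}h := cont_rae_eq L0 (cc _ _ iv) (cc _ _ iv') h.
have ccE : c = c'.
  by have := h 0; rewrite lexx ltW// !rint0 !addr0; exact.
split => //.
have : rae L (fun x => v x - v' x) (fun=> 0).
  apply: prim_inj => //; first exact: integB.
  move=> x xL; rewrite rintB; [|exact: integS iv|exact: integS iv'].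
  by have := h x xL; rewrite ccE => /addrI ->; rewrite subrr.
by apply: filterS => x {}h xL; apply/eqP; rewrite -subr_eq0 h.
Qed.


End DuBoisReymond.

(** * Closedness of differentiation in L^2 *)

Section Closedness.
Context {R : realType}.
Notation mu := (@lebesgue_measure R).
Implicit Types (L x c a b h : R) (u v w : R -> R).

Lemma rint_derive x (F F' : R -> R) : (forall t : R, is_derive t (1 : R) F (F' t)) ->
  continuous F' -> 0 <= x -> F x = F 0 + rint x F'.
Proof.
move=> dF cF'; rewrite le_eqVlt => /predU1P[<-|x0]; first by rewrite rint0 addr0.
have cF t : {for t, continuous F}.
  apply: differentiable_continuous; apply/derivable1_diffP.
  by case: (dF t).
rewrite /rint /Rintegral (@continuous_FTC2 R _ F)//=.
- by rewrite subrKC.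
- exact: continuous_subspaceT.
- split; first by move=> t _; case: (dF t).
    by apply: cvg_at_right_filter; exact: cF.
  by apply: cvg_at_left_filter; exact: cF.
- by move=> t _; rewrite derive1E; case: (dF t).
Qed.

Lemma cvg0_sqr_le (y s : nat -> R) : (forall n, y n ^+ 2 <= s n) ->
  s n @[n --> \oo] --> 0 -> y n @[n --> \oo] --> 0.
Proof.
move=> ys s0; apply/cvgrPdist_le => e e0.
have /cvgrPdist_le/(_ (e ^+ 2)) := s0; rewrite exprn_gt0// => /(_ isT).
apply: filterS => n; rewrite !sub0r !normrN => sn.
rewrite -(@ler_pXn2r _ 2)// ?nnegrE ?(ltW e0)// real_normK ?num_real//.
by apply: le_trans (ys n) _; apply: le_trans (ler_norm _) sn.
Qed.

Lemma cvg0_le (y s : nat -> R) : (forall n, 0 <= y n <= s n) ->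
  s n @[n --> \oo] --> 0 -> y n @[n --> \oo] --> 0.
Proof.
move=> ys s0; apply: (squeeze_cvgr _ (cvg_cst 0) s0).
by apply: nearW => n; exact: ys.
Qed.

Lemma cvg0D (s t : nat -> R) : s n @[n --> \oo] --> 0 -> t n @[n --> \oo] --> 0 ->
  s n + t n @[n --> \oo] --> 0.
Proof. by move=> s0 t0; rewrite -[X in _ --> X](addr0 0); exact: cvgD. Qed.

Lemma cvg0Z k (s : nat -> R) : s n @[n --> \oo] --> 0 -> k * s n @[n --> \oo] --> 0.
Proof. by move=> s0; rewrite -[X in _ --> X](mulr0 k); exact: cvgMr. Qed.

Definition l2cvg L (un : nat -> R -> R) u :=
  sqn L (fun x => un n x - u x) @[n --> \oo] --> 0.

Lemma l2cvg_lin L a b (un vn : nat -> R -> R) u v :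
  (forall n, sqint L (un n)) -> (forall n, sqint L (vn n)) ->
  sqint L u -> sqint L v -> l2cvg L un u -> l2cvg L vn v ->
  l2cvg L (fun n x => a * un n x + b * vn n x) (fun x => a * u x + b * v x).
Proof.
move=> sun svn su sv cu cv.
apply: (@cvg0_le _ (fun n => 2 * (a ^+ 2 * sqn L (fun x => un n x - u x))
    + 2 * (b ^+ 2 * sqn L (fun x => vn n x - v x)))) => [n|]; last first.
  by apply: cvg0D; apply/cvg0Z/cvg0Z.
have s1 : sqint L (fun x => un n x - u x) by exact: sqintB.
have s2 : sqint L (fun x => vn n x - v x) by exact: sqintB.
rewrite sqn_ge0/= -!sqnZ//.
apply: le_trans (sqnD_le (sqintZ a s1) (sqintZ b s2)).
rewrite le_eqVlt; apply/orP; left; apply/eqP; congr (sqn _ _).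
by apply/funext => x; ring.
Qed.

Lemma l2cvg_ae L (un vn : nat -> R -> R) u v :
  (forall n, sqint L (un n)) -> (forall n, sqint L (vn n)) ->
  sqint L u -> sqint L v -> (forall n, rae L (un n) (vn n)) -> rae L u v ->
  l2cvg L un u -> l2cvg L vn v.
Proof.
move=> sun svn su sv uvn uv; rewrite /l2cvg.
rewrite (_ : (fun n => sqn L (fun x => un n x - u x)) =
             (fun n => sqn L (fun x => vn n x - v x)))//.
apply/funext => n; apply: sqn_ae; [exact: sqintB|exact: sqintB|].
by move: (uvn n) uv; apply: filterS2 => x h1 h2 xL; rewrite h1// h2.
Qed.

Lemma l2cvg_uniq L (un : nat -> R -> R) u v :
  (forall n, sqint L (un n)) -> sqint L u -> sqint L v ->
  l2cvg L un u -> l2cvg L un v -> rae L u v.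
Proof.
move=> sun su sv cu cv.
have := l2cvg_lin 1 (-1) sun sun su sv cu cv.
rewrite /l2cvg (_ : (fun n => _) = (fun=> sqn L (fun x => u x - v x))); last first.
  apply/funext => n; rewrite -[RHS]mul1r -[X in X * _](expr1n R 2) -sqrrN -sqnZ.
    by congr (sqn _ _); apply/funext => x; ring.
  exact: sqintB.
move=> /cvg_lim/= uv0.
have : rae L (fun x => u x - v x) (fun=> 0).
  apply: sqn0; first exact: sqintB.
  by rewrite -[RHS]uv0// lim_cst.
by apply: filterS => x h xL; apply/eqP; rewrite -subr_eq0 h.
Qed.

Lemma rint_cvg L x (vn : nat -> R -> R) v : (forall n, sqint L (vn n)) ->
  sqint L v -> 0 <= x <= L -> l2cvg L vn v ->
  rint x (vn n) @[n --> \oo] --> rint x v.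
Proof.
move=> svn sv xL cv; apply/subr_cvg0.
apply: (@cvg0_sqr_le _ (fun n => L * sqn L (fun t => vn n t - v t))); last exact: cvg0Z.
move=> n; rewrite /= -rintB; [|exact: integS xL (sqint_integ _)..].
by apply: rint_sqr_le => //; exact: sqintB.
Qed.

Lemma sqn_prim L v : 0 < L -> sqint L v ->
  sqn L (fun x => rint x v) <= L * sqn L v * L.
Proof.
move=> L0 sv; rewrite -rint_cst; last exact: ltW.
apply: rint_le.
- have := prim_sqint 0 (ltW L0) (sqint_integ sv) => -[_].
  by under eq_fun do rewrite add0r.
- exact: integ_cst.
- by move=> x; rewrite /= in_itv/= => xL; exact: rint_sqr_le.
Qed.

Lemma l2cvg_cst L (cn : nat -> R) c : 0 < L -> cn n @[n --> \oo] --> c ->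
  l2cvg L (fun n _ => cn n) (fun=> c).
Proof.
move=> L0 cc; rewrite /l2cvg; apply: (@cvg0_le _ (fun n => L * (cn n - c) ^+ 2)).
  by move=> n; rewrite sqn_ge0/= /sqn (rint_cst _ (ltW L0)) mulrC.
apply: cvg0Z; rewrite -[X in _ --> X](mulr0 (0 : R)).
have h : cn n - c @[n --> \oo] --> 0 by exact/subr_cvg0.
rewrite (_ : (fun n => _) = (fun n => (cn n - c) * (cn n - c))).
  exact: cvgM.
by apply/funext => n; rewrite expr2.
Qed.

Lemma sqint_rint L v : 0 < L -> sqint L v -> sqint L (fun x => rint x v).
Proof. by move=> L0 /sqint_integ/(prim_cont (ltW L0))/sqint_cont. Qed.

Lemma l2cvg_rint L (vn : nat -> R -> R) v : 0 < L -> (forall n, sqint L (vn n)) ->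
  sqint L v -> l2cvg L vn v ->
  l2cvg L (fun n x => rint x (vn n)) (fun x => rint x v).
Proof.
move=> L0 svn sv cv.
apply: (@cvg0_le _ (fun n => L * (L * sqn L (fun x => vn n x - v x)))); last first.
  by apply/cvg0Z/cvg0Z.
move=> n; rewrite sqn_ge0/= mulrC.
apply: le_trans (sqn_prim L0 (sqintB (svn n) sv)).
rewrite le_eqVlt; apply/orP; left; apply/eqP; apply: eq_rint => x.
by rewrite /= in_itv/= => xL; rewrite rintB//; exact: integS xL (sqint_integ _).
Qed.

Lemma l2cvg_prim L (cn : nat -> R) (vn : nat -> R -> R) c v : 0 < L ->
  (forall n, sqint L (vn n)) -> sqint L v ->
  cn n @[n --> \oo] --> c -> l2cvg L vn v ->
  l2cvg L (fun n x => cn n + rint x (vn n)) (fun x => c + rint x v).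
Proof.
move=> L0 svn sv cc cv.
have sP n := sqint_rint L0 (svn n).
have := l2cvg_lin 1 1 (fun n => sqint_cst L (cn n)) sP (sqint_cst L c)
  (sqint_rint L0 sv) (l2cvg_cst L0 cc) (l2cvg_rint L0 svn sv cv).
apply: l2cvg_ae.
- by move=> n; apply: sqintD; apply: sqintZ => //; exact: sqint_cst.
- by move=> n; apply: sqintD => //; exact: sqint_cst.
- by apply: sqintD; apply: sqintZ; [exact: sqint_cst|exact: sqint_rint].
- by apply: sqintD; [exact: sqint_cst|exact: sqint_rint].
- by move=> n; apply: eq_rae => x _; ring.
- by apply: eq_rae => x _; ring.
Qed.

(** The constant functions [c_n = u_n - \int v_n] converge in L^2 to
    [w = u - \int v], so they converge to the mean of [w], and [w] is this mean. *)
Lemma prim_closed L (un vn : nat -> R -> R) (cn : nat -> R) u v : 0 < L ->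
  (forall n, sqint L (un n)) -> (forall n, sqint L (vn n)) ->
  sqint L u -> sqint L v ->
  (forall n, rae L (un n) (fun x => cn n + rint x (vn n))) ->
  l2cvg L un u -> l2cvg L vn v ->
  exists c, rae L u (fun x => c + rint x v) /\
    forall x, 0 <= x <= L ->
      cn n + rint x (vn n) @[n --> \oo] --> c + rint x v.
Proof.
move=> L0 sun svn su sv uvn cu cv.
have sP n := sqint_rint L0 (svn n); have sPv := sqint_rint L0 sv.
pose w x := u x - rint x v.
have sw : sqint L w by exact: sqintB.
have cw : l2cvg L (fun n _ => cn n) w.
  apply: (@l2cvg_ae _ (fun n x => 1 * un n x + -1 * rint x (vn n)) _
    (fun x => 1 * u x + -1 * rint x v)).
  - by move=> n; apply: sqintD; exact: sqintZ.
  - by move=> n; exact: sqint_cst.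
  - by apply: sqintD; exact: sqintZ.
  - exact: sw.
  - by move=> n; apply: filterS (uvn n) => x h xL; rewrite h//; ring.
  - by apply: eq_rae => x _; rewrite /w; ring.
  - by apply: l2cvg_lin => //; exact: l2cvg_rint.
pose c := rint L w / L.
have cc : cn n @[n --> \oo] --> c.
  have := rint_cvg (fun n => sqint_cst L (cn n)) sw _ cw => /(_ L).
  rewrite lexx ltW// => /(_ isT) h.
  have -> : cn = (fun n => rint L (fun=> cn n) / L).
    by apply/funext => n; rewrite rint_cst ?ltW// mulfK// gt_eqF.
  exact: cvgMl.
exists c; split; last first.
  by move=> x xL; apply: cvgD => //; exact: rint_cvg xL cv.
have : rae L w (fun=> c).
  apply: (l2cvg_uniq _ sw (sqint_cst _ _) cw (l2cvg_cst L0 cc)) => n.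
  exact: sqint_cst.
by apply: filterS => x h xL; rewrite -h// /w subrK.
Qed.

End Closedness.

(** * Complex-valued Sobolev functions *)

Section ComplexFunctions.
Context {R : realType}.
Notation mu := (@lebesgue_measure R).
Implicit Types (L x : R) (a c d z : R[i]) (u v w : R -> R[i]) (b : bool).

(** Indexing the two parts by a boolean transfers each statement on real functions
    to complex ones by a single quantification. *)
Definition part b z : R := if b then complex.Re z else complex.Im z.

Lemma part_eq z a : (forall b, part b z = part b a) -> z = a.
Proof. by case: z a => [x y] [x' y'] h; have /= := h true; have /= := h false => -> ->. Qed.

Lemma partD b z a : part b (z + a) = part b z + part b a.
Proof. by case: b z a => -[x y] [x' y']. Qed.

Lemma partN b z : part b (- z) = - part b z.
Proof. by case: b z => -[x y]. Qed.

Lemma part0 b : part b 0 = 0.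
Proof. by case: b. Qed.

Lemma part_mulr b z (r : R) : part b (z * r%:C%C) = part b z * r.
Proof. by case: b z => -[x y] /=; ring. Qed.

Lemma partM b a z : part b (a * z) =
  complex.Re a * part b z + (if b then - complex.Im a else complex.Im a) * part (~~ b) z.
Proof. by case: b a z => -[x y] [x' y'] /=; ring. Qed.

Lemma part_cintegral b L u : part b (cintegral L u) = rint L (part b \o u).
Proof. by case: b. Qed.

Lemma L2P L u : L2 L u <-> forall b, sqint L (part b \o u).
Proof.
have sumE : (fun x => (complex.Re (u x) ^+ 2 + complex.Im (u x) ^+ 2)%:E) =
    EFin \o (fun x => complex.Re (u x) ^+ 2 + complex.Im (u x) ^+ 2) by [].
split=> [[mr mi]|h].
  rewrite sumE => iu; case; split => //.
    apply: (integ_le _ _ iu); first by move: mr; apply: measurable_funX.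
    by move=> x _ /=; rewrite ger0_norm ?sqr_ge0// lerDl sqr_ge0.
  apply: (integ_le _ _ iu); first by move: mi; apply: measurable_funX.
  by move=> x _ /=; rewrite ger0_norm ?sqr_ge0// lerDr sqr_ge0.
split; [exact: (h true).1|exact: (h false).1|rewrite sumE].
by apply: integD; [exact: (h true).2|exact: (h false).2].
Qed.

Lemma aeqP L u v : aeq L u v <-> forall b, rae L (part b \o u) (part b \o v).
Proof.
split=> [uv b|h].
  by apply: filterS uv => x h xL /=; rewrite h.
apply: filterS2 (h true) (h false) => x h1 h2 xL.
by apply: part_eq => -[]; [exact: h1|exact: h2].
Qed.

Lemma aeq_refl L u : aeq L u u.
Proof. exact: aeW. Qed.

Lemma aeq_sym L u v : aeq L u v -> aeq L v u.
Proof. by apply: filterS => t h tL; rewrite h. Qed.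

Lemma aeq_trans L u v w : aeq L u v -> aeq L v w -> aeq L u w.
Proof. by apply: filterS2 => t h1 h2 tL; rewrite h1// h2. Qed.

Lemma eq_aeq L u v : (forall x, `[0, L]%classic x -> u x = v x) -> aeq L u v.
Proof. by move=> uv; exact: aeW. Qed.

Lemma aeq_lin L a u u' v v' : aeq L u u' -> aeq L v v' ->
  aeq L (fun x => a * u x + v x) (fun x => a * u' x + v' x).
Proof. by apply: filterS2 => x h1 h2 xL; rewrite h1// h2. Qed.

Lemma L2_lin L a u v : L2 L u -> L2 L v -> L2 L (fun x => a * u x + v x).
Proof.
move=> /L2P su /L2P sv; apply/L2P => b.
have -> : part b \o (fun x => a * u x + v x) = (fun x => (complex.Re a * part b (u x) +
    (if b then - complex.Im a else complex.Im a) * part (~~ b) (u x)) + part b (v x)).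
  by apply/funext => x /=; rewrite partD partM.
by apply: sqintD; [apply: sqintD; apply: sqintZ; exact: su|exact: sv].
Qed.

Lemma L2_cst L c : L2 L (fun=> c).
Proof. by apply/L2P => b; exact: sqint_cst. Qed.

Lemma L2Z L a u : L2 L u -> L2 L (fun x => a * u x).
Proof.
move=> su; have := L2_lin a su (L2_cst L 0).
by under eq_fun do rewrite addr0.
Qed.

Lemma L2_int L u b : L2 L u -> integ L (part b \o u).
Proof. by move=> /L2P su; exact: sqint_integ. Qed.

Lemma cintegral_lin L a u v x : 0 <= x <= L -> L2 L u -> L2 L v ->
  cintegral x (fun t => a * u t + v t) = a * cintegral x u + cintegral x v.
Proof.
move=> xL su sv; apply: part_eq => b; rewrite partD partM !part_cintegral.
have iu b' : integ x (part b' \o u) by apply: integS xL _; exact: L2_int.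
have iv : integ x (part b \o v) by apply: integS xL _; exact: L2_int.
rewrite -!rintZ// -rintD; [|exact: integZ|exact: integZ].
rewrite -rintD//; last by apply: integD; exact: integZ.
by apply: eq_rint => t _ /=; rewrite partD partM.
Qed.

Lemma cintegral0 u : cintegral 0 u = 0.
Proof. by apply: part_eq => b; rewrite part_cintegral rint0 part0. Qed.

Lemma cintegral_zero x : cintegral x (fun=> 0) = 0.
Proof. by apply: part_eq => -[]; exact: rint_zero. Qed.

Lemma L2_prim L c v : 0 < L -> L2 L v -> L2 L (fun x => c + cintegral x v).
Proof.
move=> L0 /L2P sv; apply/L2P => b.
have -> : part b \o (fun x => c + cintegral x v) =
    (fun x => part b c + rint x (part b \o v)).
  by apply/funext => x /=; rewrite partD part_cintegral.
by apply: prim_sqint; [exact: ltW|exact: sqint_integ].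
Qed.

(** [cintegral x v] is the integral of [v] over [0, x].  The relation therefore
    says that [u] is in H^1 with derivative [v] and initial value [c]. *)
Definition primitive L u c v :=
  [/\ L2 L u, L2 L v & aeq L u (fun x => c + cintegral x v)].

Lemma aeq_prim_part L u c v :
  aeq L u (fun x => c + cintegral x v) <->
  forall b, rae L (part b \o u) (fun x => part b c + rint x (part b \o v)).
Proof.
have e b : part b \o (fun x => c + cintegral x v) =
    (fun x => part b c + rint x (part b \o v)).
  by apply/funext => x /=; rewrite partD part_cintegral.
by split=> [/aeqP h b|h]; [rewrite -e|apply/aeqP => b; rewrite e].
Qed.

Lemma primitive_self L c v : 0 < L -> L2 L v ->
  primitive L (fun x => c + cintegral x v) c v.
Proof. by move=> L0 sv; split => //; [exact: L2_prim|exact: aeq_refl]. Qed.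

Lemma primitive_ae L u u' c v v' : 0 < L -> L2 L u' -> L2 L v' ->
  aeq L u u' -> aeq L v v' -> primitive L u c v -> primitive L u' c v'.
Proof.
move=> L0 su' sv' uu' vv' [su sv uv]; split => //.
apply: (aeq_trans (aeq_sym uu')); apply: (aeq_trans uv).
apply: eq_aeq => x; rewrite /= in_itv/= => /andP[x0 xL]; congr (_ + _).
apply: part_eq => b; rewrite !part_cintegral.
have xL' : 0 <= x <= L by rewrite x0.
apply: rint_ae; [exact: integ_meas (integS xL' (L2_int b sv))|
  exact: integ_meas (integS xL' (L2_int b sv'))|].
by apply: (raeS xL); move/aeqP : vv'; exact.
Qed.

Lemma primitive_lin L a u u' c c' v v' : 0 < L ->
  primitive L u c v -> primitive L u' c' v' ->
  primitive L (fun x => a * u x + u' x) (a * c + c') (fun x => a * v x + v' x).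
Proof.
move=> L0 [su sv uv] [su' sv' uv']; split; [exact: L2_lin|exact: L2_lin|].
apply: (aeq_trans (aeq_lin a uv uv')); apply: eq_aeq => x.
by rewrite /= in_itv/= => xL; rewrite (cintegral_lin _ xL)//; ring.
Qed.

Lemma weak_derivativeP L u v :
  weak_derivative L u v <-> forall b, rweak L (part b \o u) (part b \o v).
Proof.
have e b (w : R -> R[i]) (phi : R -> R) :
    part b (cintegral L (fun x => w x * (phi x)%:C%C)) =
    rint L (fun x => (part b \o w) x * phi x).
  by rewrite part_cintegral; apply: eq_rint => x _ /=; rewrite part_mulr.
split=> [h b phi tphi|h phi tphi].
  by rewrite -!e h// partN.
by apply: part_eq => b; rewrite partN !e h.
Qed.

Lemma primitive_weak L u c v : 0 < L -> primitive L u c v -> weak_derivative L u v.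
Proof.
move=> L0 [/L2P su /L2P sv /aeq_prim_part uv]; apply/weak_derivativeP => b.
exact: rweak_prim (uv b).
Qed.

Lemma weak_primitive L u v : 0 < L -> L2 L u -> L2 L v ->
  weak_derivative L u v -> exists c, primitive L u c v.
Proof.
move=> L0 su sv /weak_derivativeP uv.
have h b : exists c : R, rae L (part b \o u) (fun x => c + rint x (part b \o v)).
  by apply/rweakP => //; move: b; apply/L2P.
have [c1 h1] := h true; have [c2 h2] := h false.
exists (Complex c1 c2); split => //; apply/aeq_prim_part.
by case.
Qed.

Lemma primitive_uniq L u c c' v v' : 0 < L -> primitive L u c v ->
  primitive L u c' v' -> c = c' /\ aeq L v v'.
Proof.
move=> L0 [su sv /aeq_prim_part uv] [_ sv' /aeq_prim_part uv'].
have h b : part b c = part b c' /\ rae L (part b \o v) (part b \o v').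
  apply: prim_uniq => //; [exact: L2_int|exact: L2_int|].
  exact: rae_trans (rae_sym (uv b)) (uv' b).
by split; [apply: part_eq => b; case: (h b)|apply/aeqP => b; case: (h b)].
Qed.

Lemma wDP L u c v : 0 < L -> primitive L u c v ->
  primitive L u c (wD L u) /\ aeq L v (wD L u).
Proof.
move=> L0 uv; have [su sv _] := uv.
have [sw wk] : L2 L (wD L u) /\ weak_derivative L u (wD L u).
  rewrite /wD; set A := [set _ | _].
  have : A (xget (fun=> 0) A); last by [].
  by apply: xgetPex; exists v; split => //; exact: primitive_weak uv.
have [c' uw] := weak_primitive L0 su sw wk.
by have [cc vw] := primitive_uniq L0 uv uw; split; rewrite // cc.
Qed.

Lemma trace_cont L u v x : 0 < L -> 0 <= x <= L ->
  (forall b, {within `[0, L], continuous (part b \o v)}) -> aeq L u v ->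
  trace L u x = v x.
Proof.
move=> L0 xL cv uv; rewrite /trace; set A := [set _ | _].
have : A (xget 0 A).
  apply: xgetPex; exists (v x), v.
  by split; [exact: (cv true)|exact: (cv false)|exact: uv|].
move=> [w [cr ci uw <-]]; apply: part_eq => b.
have cw b' : {within `[0, L], continuous (part b' \o w)} by case: b'.
have /aeqP/(_ b) := aeq_trans (aeq_sym uw) uv.
by move=> /(cont_rae_eq L0 (cw b) (cv b)); exact.
Qed.

Lemma trace_primitive L u c v x : 0 < L -> 0 <= x <= L -> primitive L u c v ->
  trace L u x = c + cintegral x v.
Proof.
move=> L0 xL [su sv uv]; apply: (trace_cont L0 xL _ uv) => b.
have -> : part b \o (fun x => c + cintegral x v) =
    (fun x => part b c + rint x (part b \o v)).
  by apply/funext => y /=; rewrite partD part_cintegral.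
apply/subspace_continuousP => y yL; apply: cvgD; first exact: cvg_cst.
by have /subspace_continuousP := prim_cont (ltW L0) (L2_int b sv); exact.
Qed.

Lemma trace0_primitive L u c v : 0 < L -> primitive L u c v -> trace L u 0 = c.
Proof.
move=> L0 uv; rewrite (trace_primitive L0 _ uv) ?lexx ?ltW//.
by rewrite cintegral0 addr0.
Qed.

Lemma sobolev_L2 L k u : sobolev L k u -> L2 L u.
Proof. by case: k => [|k] // []. Qed.

(** [L2] asks for a Borel measurable representative, which almost everywhere
    equality alone does not transfer; hence the hypothesis on [u']. *)
Lemma sobolev_ae L k u u' : 0 < L -> L2 L u' -> aeq L u u' -> sobolev L k u ->
  sobolev L k u'.
Proof.
move=> L0 su' uu'; case: k => [|k] //= [su [v [uv kv]]]; split => //.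
exists v; split => //; have sv := sobolev_L2 kv.
have [c h] := weak_primitive L0 su sv uv.
exact: primitive_weak (primitive_ae L0 su' sv uu' (aeq_refl L v) h).
Qed.

Lemma sobolevS L k u : 0 < L -> sobolev L k.+1 u ->
  primitive L u (trace L u 0) (wD L u) /\ sobolev L k (wD L u).
Proof.
move=> L0 /= [su [v [uv kv]]]; have sv := sobolev_L2 kv.
have [c h] := weak_primitive L0 su sv uv.
have [h1 h2] := wDP L0 h.
by rewrite (trace0_primitive L0 h1); split => //; apply: sobolev_ae kv => //; case: h1.
Qed.

Lemma primitive_sobolev L k u c v : 0 < L -> primitive L u c v ->
  sobolev L k v -> sobolev L k.+1 u.
Proof.
move=> L0 uv kv; split; first by case: uv.
by exists v; split => //; exact: primitive_weak uv.
Qed.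

Lemma wD2P L u c v d w : 0 < L -> primitive L u c v -> primitive L v d w ->
  primitive L (wD L u) d (wDn L 2 u) /\ aeq L w (wDn L 2 u).
Proof.
move=> L0 uv vw; have [[_ su' _] vu'] := wDP L0 uv.
have [_ sw _] := vw.
by apply: wDP => //; exact: primitive_ae vu' (aeq_refl L w) vw.
Qed.

Definition cl2cvg L (un : nat -> R -> R[i]) u :=
  forall b, l2cvg L (fun n => part b \o un n) (part b \o u).

Definition ccvg (zn : nat -> R[i]) z :=
  forall b, part b (zn n) @[n --> \oo] --> part b z.

Lemma cl2cvg_lin L a (un vn : nat -> R -> R[i]) u v :
  (forall n, L2 L (un n)) -> (forall n, L2 L (vn n)) -> L2 L u -> L2 L v ->
  cl2cvg L un u -> cl2cvg L vn v ->
  cl2cvg L (fun n x => a * un n x + vn n x) (fun x => a * u x + v x).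
Proof.
move=> sun svn /L2P su /L2P sv cu cv b.
have {}sun n b' : sqint L (part b' \o un n) by move: b'; apply/L2P.
have {}svn n b' : sqint L (part b' \o vn n) by move: b'; apply/L2P.
pose k := if b then - complex.Im a else complex.Im a.
have h := l2cvg_lin (complex.Re a) k (fun n => sun n b) (fun n => sun n (~~ b))
  (su b) (su (~~ b)) (cu b) (cu (~~ b)).
have s1 (u1 u2 : R -> R) : sqint L u1 -> sqint L u2 ->
    sqint L (fun x => complex.Re a * u1 x + k * u2 x).
  by move=> *; apply: sqintD; exact: sqintZ.
have := l2cvg_lin 1 1 (fun n => s1 _ _ (sun n b) (sun n (~~ b))) (fun n => svn n b)
  (s1 _ _ (su b) (su (~~ b))) (sv b) h (cv b).
have pE (w z : R -> R[i]) : part b \o (fun x => a * w x + z x) =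
    (fun x => 1 * (complex.Re a * part b (w x) + k * part (~~ b) (w x)) + 1 * part b (z x)).
  by apply/funext => x /=; rewrite partD partM !mul1r.
have pnE : (fun n => part b \o (fun n x => a * un n x + vn n x) n) =
    (fun n x => 1 * (complex.Re a * part b (un n x) + k * part (~~ b) (un n x))
                + 1 * part b (vn n x)).
  by apply/funext => n; exact: pE.
by rewrite pE pnE.
Qed.

Lemma cl2cvg_ae L (un vn : nat -> R -> R[i]) u v :
  (forall n, L2 L (un n)) -> (forall n, L2 L (vn n)) -> L2 L u -> L2 L v ->
  (forall n, aeq L (un n) (vn n)) -> aeq L u v ->
  cl2cvg L un u -> cl2cvg L vn v.
Proof.
move=> sun svn /L2P su /L2P sv uvn /aeqP uv cu b.
apply: l2cvg_ae (cu b) => //.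
- by move=> n; move: b; apply/L2P.
- by move=> n; move: b; apply/L2P.
- by move=> n; move: b; apply/aeqP.
Qed.

Lemma cl2cvg_uniq L (un : nat -> R -> R[i]) u v :
  (forall n, L2 L (un n)) -> L2 L u -> L2 L v ->
  cl2cvg L un u -> cl2cvg L un v -> aeq L u v.
Proof.
move=> sun /L2P su /L2P sv cu cv; apply/aeqP => b.
by apply: l2cvg_uniq (cu b) (cv b) => // n; move: b; apply/L2P.
Qed.

(** The limits of the point values are what transfers the boundary conditions to
    the limit. *)
Lemma primitive_closed L (un vn : nat -> R -> R[i]) (cn : nat -> R[i]) u v : 0 < L ->
  (forall n, primitive L (un n) (cn n) (vn n)) -> L2 L u -> L2 L v ->
  cl2cvg L un u -> cl2cvg L vn v ->
  exists c, primitive L u c v /\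
    forall x, 0 <= x <= L ->
      ccvg (fun n => cn n + cintegral x (vn n)) (c + cintegral x v).
Proof.
move=> L0 uvn su sv cu cv.
have h b : exists c : R, rae L (part b \o u) (fun x => c + rint x (part b \o v)) /\
    forall x, 0 <= x <= L ->
      part b (cn n) + rint x (part b \o vn n) @[n --> \oo] --> c + rint x (part b \o v).
  apply: (prim_closed L0) (cu b) (cv b) => //.
  - by move=> n; have [/L2P sun _ _] := uvn n; exact: sun.
  - by move=> n; have [_ /L2P svn _] := uvn n; exact: svn.
  - by move/L2P : su; exact.
  - by move/L2P : sv; exact.
  - by move=> n; have [_ _ /aeq_prim_part h] := uvn n; exact: h.
have [c1 [h1 k1]] := h true; have [c2 [h2 k2]] := h false.
exists (Complex c1 c2); split; first by split => //; apply/aeq_prim_part => -[].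
move=> x xL b; rewrite partD part_cintegral.
rewrite (_ : (fun n => _) = (fun n => part b (cn n) + rint x (part b \o vn n))).
  by case: b; [exact: k1|exact: k2].
by apply/funext => n; rewrite partD part_cintegral.
Qed.

(** Integration is continuous in L^2; used to come down from the highest
    derivatives to the lower ones. *)
Lemma cl2cvg_primitive L (un vn : nat -> R -> R[i]) (cn : nat -> R[i]) c v : 0 < L ->
  (forall n, primitive L (un n) (cn n) (vn n)) -> ccvg cn c -> L2 L v ->
  cl2cvg L vn v -> cl2cvg L un (fun x => c + cintegral x v).
Proof.
move=> L0 uvn cc sv cv b.
have svn n : sqint L (part b \o vn n).
  by have [_ /L2P svn _] := uvn n; exact: svn.
have svb : sqint L (part b \o v) by move/L2P : sv; exact.
apply: l2cvg_ae (l2cvg_prim L0 svn svb (cc b) (cv b)).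
- by move=> n; apply: prim_sqint; [exact: ltW|exact: sqint_integ].
- by move=> n; have [/L2P sun _ _] := uvn n; exact: sun.
- by apply: prim_sqint; [exact: ltW|exact: sqint_integ].
- by move/L2P : (L2_prim c L0 sv); exact.
- by move=> n; have [_ _ /aeq_prim_part h] := uvn n; exact: rae_sym.
- by apply: eq_rae => x _ /=; rewrite partD part_cintegral.
Qed.

Lemma cl2cvgZ L a (un : nat -> R -> R[i]) u : (forall n, L2 L (un n)) -> L2 L u ->
  cl2cvg L un u -> cl2cvg L (fun n x => a * un n x) (fun x => a * u x).
Proof.
move=> sun su cu.
have c0 : cl2cvg L (fun _ _ => 0) (fun=> 0).
  move=> b; rewrite /l2cvg (_ : (fun n => _) = (fun=> 0)); first exact: cvg_cst.
  apply/funext => n; rewrite -(rint_zero L); apply: eq_rint => x _.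
  by rewrite /= subrr expr0n.
have := cl2cvg_lin a sun (fun=> L2_cst L 0) su (L2_cst L 0) cu c0.
apply: cl2cvg_ae.
- by move=> n; apply: L2_lin => //; exact: L2_cst.
- by move=> n; exact: L2Z.
- by apply: L2_lin => //; exact: L2_cst.
- exact: L2Z.
- by move=> n; apply: eq_aeq => x _; rewrite addr0.
- by apply: eq_aeq => x _; rewrite addr0.
Qed.

Lemma ccvgD (yn zn : nat -> R[i]) y z : ccvg yn y -> ccvg zn z ->
  ccvg (fun n => yn n + zn n) (y + z).
Proof.
move=> cy cz b; rewrite partD; under eq_fun do rewrite partD.
by apply: cvgD; [exact: cy|exact: cz].
Qed.

Lemma ccvgZ a (zn : nat -> R[i]) z : ccvg zn z -> ccvg (fun n => a * zn n) (a * z).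
Proof.
move=> cz b; rewrite partM; under eq_fun do rewrite partM.
by apply: cvgD; apply: cvgMr; exact: cz.
Qed.

Lemma ccvg_cst z : ccvg (fun=> z) z.
Proof. by move=> b; exact: cvg_cst. Qed.

Lemma ccvg_cintegral L x (vn : nat -> R -> R[i]) v : 0 <= x <= L ->
  (forall n, L2 L (vn n)) -> L2 L v -> cl2cvg L vn v ->
  ccvg (fun n => cintegral x (vn n)) (cintegral x v).
Proof.
move=> xL svn sv cv b; rewrite part_cintegral; under eq_fun do rewrite part_cintegral.
apply: rint_cvg xL (cv b); last by move/L2P : sv; exact.
by move=> n; move/L2P : (svn n); exact.
Qed.

Lemma trace_ccvg L x (un vn : nat -> R -> R[i]) (cn : nat -> R[i]) u c v : 0 < L ->
  0 <= x <= L -> (forall n, primitive L (un n) (cn n) (vn n)) -> primitive L u c v ->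
  ccvg (fun n => cn n + cintegral x (vn n)) (c + cintegral x v) ->
  ccvg (fun n => trace L (un n) x) (trace L u x).
Proof.
move=> L0 xL uvn uv; rewrite (trace_primitive L0 xL uv).
rewrite (_ : (fun n => trace L (un n) x) = (fun n => cn n + cintegral x (vn n)))//.
by apply/funext => n; exact: trace_primitive (uvn n).
Qed.

Lemma ccvg_uniq (zn : nat -> R[i]) y z : ccvg zn y -> ccvg zn z -> y = z.
Proof.
move=> cy cz; apply: part_eq => b.
exact: (cvg_unique (@Rhausdorff R) (cy b) (cz b)).
Qed.

Lemma primitiveZ L a u c v : 0 < L -> primitive L u c v ->
  primitive L (fun x => a * u x) (a * c) (fun x => a * v x).
Proof.
move=> L0 uv; have := primitive_lin a L0 uv (primitive_self 0 L0 (L2_cst L 0)).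
have [su sv _] := uv; rewrite addr0; apply: primitive_ae => //; try exact: L2Z.
- by apply: eq_aeq => x _; rewrite add0r [cintegral x _]cintegral_zero addr0.
- by apply: eq_aeq => x _; rewrite addr0.
Qed.

End ComplexFunctions.

(** * The energy norm of the beam *)

#[local] Opaque wD trace.

Section Beam.
Context {R : realType}.
Notation mu := (@lebesgue_measure R).
Variables (L m J S E G Cp : R).
Hypotheses (L_gt0 : 0 < L) (S_gt0 : 0 < S) (E_gt0 : 0 < E) (G_gt0 : 0 < G)
  (Cp_gt0 : 0 < Cp) (Sm : S < m) (SJ : S < J).
Implicit Types (f g : state R) (u v w : R -> R[i]).

Notation dot := (beam_dot L m J S E G Cp).

Lemma beam_spaceE f : beam_space L f ->
  [/\ primitive L (f0 f) 0 (wD L (f0 f)),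
      primitive L (wD L (f0 f)) 0 (wDn L 2 (f0 f)), L2 L (f1 f),
      primitive L (f2 f) 0 (wD L (f2 f)) & L2 L (f3 f)].
Proof.
move=> [[h0 h1 h2 h3] [t0 t0' t2]].
have [p0 h0'] := sobolevS L_gt0 h0; have [p1 _] := sobolevS L_gt0 h0'.
have [p2 _] := sobolevS L_gt0 h2.
rewrite t0 in p0; rewrite t0' in p1; rewrite t2 in p2.
by split; [exact: p0|exact: p1|exact: h1|exact: p2|exact: h3].
Qed.

Lemma beam_space_intro f v w z : primitive L (f0 f) 0 v -> primitive L v 0 w ->
  L2 L (f1 f) -> primitive L (f2 f) 0 z -> L2 L (f3 f) -> beam_space L f.
Proof.
move=> p0 p1 h1 p2 h3; have [_ sw _] := p1; have [_ sz _] := p2.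
have sob w' : L2 L w' -> sobolev L 0 w' by [].
split; split => //.
- by apply: primitive_sobolev p0 _ => //; exact: primitive_sobolev p1 _.
- by apply: primitive_sobolev p2 _.
- exact: trace0_primitive p0.
- by have [q _] := wD2P L_gt0 p0 p1; exact: trace0_primitive q.
- exact: trace0_primitive p2.
Qed.

Lemma state_subE f g :
  [/\ f0 (f - g) = (fun x => f0 f x - f0 g x), f1 (f - g) = (fun x => f1 f x - f1 g x),
      f2 (f - g) = (fun x => f2 f x - f2 g x), f3 (f - g) = (fun x => f3 f x - f3 g x) &
      f4 (f - g) = f4 f - f4 g].
Proof.
(* Both sides compute once the two states are explicit tuples. *)
by case: f g => [[[[? ?] ?] ?] ?] [[[[? ?] ?] ?] ?]; split; reflexivity.
Qed.

Lemma beam_diff f g : beam_space L f -> beam_space L g ->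
  [/\ beam_space L (f - g),
   aeq L (wDn L 2 (f0 (f - g))) (fun x => -1 * wDn L 2 (f0 g) x + wDn L 2 (f0 f) x) &
   aeq L (wD L (f2 (f - g))) (fun x => -1 * wD L (f2 g) x + wD L (f2 f) x)].
Proof.
move=> /beam_spaceE[p0 p1 h1 p2 h3] /beam_spaceE[q0 q1 g1 q2 g3].
have subE (u v : R -> R[i]) : (fun x => -1 * v x + u x) = (fun x => u x - v x).
  by apply/funext => x; ring.
have [e0 e1 e2 e3 _] := state_subE f g.
rewrite -subE in e0; rewrite -subE in e1; rewrite -subE in e2; rewrite -subE in e3.
have r0 := primitive_lin (-1) L_gt0 q0 p0; have r1 := primitive_lin (-1) L_gt0 q1 p1.
have r2 := primitive_lin (-1) L_gt0 q2 p2.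
rewrite mulr0 addr0 -e0 in r0; rewrite mulr0 addr0 in r1.
rewrite mulr0 addr0 -e2 in r2.
have s1 : L2 L (f1 (f - g)) by rewrite e1; exact: L2_lin.
have s3 : L2 L (f3 (f - g)) by rewrite e3; exact: L2_lin.
split; first exact: beam_space_intro r0 r1 s1 r2 s3.
  by have [_ h] := wD2P L_gt0 r0 r1; exact: aeq_sym.
by have [_ h] := wDP L_gt0 r2; exact: aeq_sym.
Qed.

Definition sqnorm (z : R[i]) : R := complex.Re z ^+ 2 + complex.Im z ^+ 2.

Lemma sqnorm_ge0 z : 0 <= sqnorm z.
Proof. by rewrite addr_ge0// sqr_ge0. Qed.

Lemma sqnorm_part b z : part b z ^+ 2 <= sqnorm z.
Proof. by case: b; rewrite /sqnorm/= ?lerDl ?lerDr sqr_ge0. Qed.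

Definition energy_density f x : R :=
  E * sqnorm (wDn L 2 (f0 f) x) + m * sqnorm (f1 f x) + G * sqnorm (wD L (f2 f) x)
  + J * sqnorm (f3 f x)
  + 2 * S * (complex.Re (f1 f x) * complex.Re (f3 f x)
             + complex.Im (f1 f x) * complex.Im (f3 f x)).

Lemma dot_energy f : complex.Re (dot f f) =
  2^-1 * rint L (energy_density f) + 2^-1 * Cp * sqnorm (f4 f).
Proof.
have ReMC (r : R) (z : R[i]) : complex.Re (r%:C%C * z) = r * complex.Re z.
  by case: z => a b /=; ring.
have ReD (y z : R[i]) : complex.Re (y + z) = complex.Re y + complex.Re z.
  by case: y z => [a b] [c d].
rewrite /beam_dot ReD ReMC -!mulrA !ReMC; congr (_ * _ + _ * (_ * _)).
  apply: eq_rint => x _; rewrite /energy_density /sqnorm.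
  move: (wDn L 2 (f0 f) x) (f1 f x) (wD L (f2 f) x) (f3 f x).
  by move=> [a1 b1] [a2 b2] [a3 b3] [a4 b4] /=; ring.
by case: (f4 f) => a b; rewrite /sqnorm /=; ring.
Qed.

Lemma integ_sqnorm u : L2 L u -> integ L (fun x => sqnorm (u x)).
Proof. by move=> [_ _]. Qed.

Lemma integ_energy f : beam_space L f -> integ L (energy_density f).
Proof.
move=> /beam_spaceE[p0 [_ s0 _] s1 [_ s2 _] s3]; rewrite /energy_density.
have iZ k u : L2 L u -> integ L (fun x => k * sqnorm (u x)).
  by move=> su; exact/integZ/integ_sqnorm.
apply: integD; first by apply: integD; [apply: integD; [apply: integD|]|]; exact: iZ.
move/L2P in s1; move/L2P in s3.
by apply: integZ; apply: integD; [exact: sqint_mul (s1 true) (s3 true)|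
  exact: sqint_mul (s1 false) (s3 false)].
Qed.

(** The cross term is bounded below by completing squares: [2 S a c >=
    - S (a^2 + c^2)]. *)
Lemma energy_density_ge f x :
  E * sqnorm (wDn L 2 (f0 f) x) + (m - S) * sqnorm (f1 f x)
  + G * sqnorm (wD L (f2 f) x) + (J - S) * sqnorm (f3 f x) <= energy_density f x.
Proof.
rewrite /energy_density /sqnorm.
move: (f1 f x) (f3 f x) => [a b] [c d] /=.
have h1 : 0 <= S * (a + c) ^+ 2 by rewrite mulr_ge0 ?sqr_ge0// ltW.
have h2 : 0 <= S * (b + d) ^+ 2 by rewrite mulr_ge0 ?sqr_ge0// ltW.
lra.
Qed.

(** All terms of the lower bound [energy_density_ge] are nonnegative, so each of
    them is controlled by the whole energy. *)
Lemma coercive : exists2 K : R, 0 <= K & forall f, beam_space L f ->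
  0 <= complex.Re (dot f f) /\ forall b,
  [/\ sqn L (part b \o wDn L 2 (f0 f)) <= K * complex.Re (dot f f),
      sqn L (part b \o f1 f) <= K * complex.Re (dot f f),
      sqn L (part b \o wD L (f2 f)) <= K * complex.Re (dot f f),
      sqn L (part b \o f3 f) <= K * complex.Re (dot f f) &
      part b (f4 f) ^+ 2 <= K * complex.Re (dot f f)].
Proof.
pose K := 2 / E + 2 / (m - S) + 2 / G + 2 / (J - S) + 2 / Cp.
have mS : 0 < m - S by rewrite subr_gt0.
have JS : 0 < J - S by rewrite subr_gt0.
have [i1 i2 i3 i4 i5] : [/\ 0 < 2 / E, 0 < 2 / (m - S), 0 < 2 / G,
  0 < 2 / (J - S) & 0 < 2 / Cp] by split; rewrite divr_gt0.
exists K; first by rewrite /K; lra.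
move=> f Hf; have iE := integ_energy Hf.
have lb x := energy_density_ge f x.
have h1 x : 0 <= E * sqnorm (wDn L 2 (f0 f) x) by rewrite mulr_ge0 ?sqnorm_ge0// ltW.
have h2 x : 0 <= (m - S) * sqnorm (f1 f x) by rewrite mulr_ge0 ?sqnorm_ge0// ltW.
have h3 x : 0 <= G * sqnorm (wD L (f2 f) x) by rewrite mulr_ge0 ?sqnorm_ge0// ltW.
have h4 x : 0 <= (J - S) * sqnorm (f3 f x) by rewrite mulr_ge0 ?sqnorm_ge0// ltW.
have h5 : 0 <= Cp * sqnorm (f4 f) by rewrite mulr_ge0 ?sqnorm_ge0// ltW.
have r0 : 0 <= rint L (energy_density f).
  by apply: rint_ge0 => x; apply: le_trans (lb x); rewrite !addr_ge0.
have e0 : 0 <= complex.Re (dot f f) by rewrite dot_energy; lra.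
have bound b k u : 0 < k -> 2 / k <= K -> L2 L u ->
    (forall x, k * sqnorm (u x) <= energy_density f x) ->
    sqn L (part b \o u) <= K * complex.Re (dot f f).
  move=> k0 kK su ku.
  have {}su : sqint L (part b \o u) by move/L2P : su; exact.
  have le1 : k * sqn L (part b \o u) <= rint L (energy_density f).
    rewrite -rintZ; last exact: su.2.
    apply: rint_le => //; first by apply: integZ; exact: su.2.
    by move=> x _; apply: le_trans (ku x); rewrite ler_pM2l// sqnorm_part.
  apply: (@le_trans _ _ (2 / k * complex.Re (dot f f))); last exact: ler_wpM2r.
  rewrite mulrAC ler_pdivlMr// dot_energy; lra.
split=> // b; have [p0 [_ s0 _] s1 [_ s2 _] s3] := beam_spaceE Hf; split.
- apply: (bound b E) => //; first by rewrite /K; lra.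
  by move=> x; apply: le_trans (lb x); have := (h2 x, h3 x, h4 x); case=> [[]]; lra.
- apply: (bound b (m - S)) => //; first by rewrite /K; lra.
  by move=> x; apply: le_trans (lb x); have := (h1 x, h3 x, h4 x); case=> [[]]; lra.
- apply: (bound b G) => //; first by rewrite /K; lra.
  by move=> x; apply: le_trans (lb x); have := (h1 x, h2 x, h4 x); case=> [[]]; lra.
- apply: (bound b (J - S)) => //; first by rewrite /K; lra.
  by move=> x; apply: le_trans (lb x); have := (h1 x, h2 x, h3 x); case=> [[]]; lra.
- apply: (@le_trans _ _ (2 / Cp * complex.Re (dot f f))); last first.
    by apply: ler_wpM2r => //; rewrite /K; lra.
  rewrite mulrAC ler_pdivlMr// dot_energy.
  have := ler_wpM2l (ltW Cp_gt0) (sqnorm_part b (f4 f)); lra.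
Qed.

Lemma hcvg_components (un : nat -> state R) f :
  (forall n, beam_space L (un n)) -> beam_space L f -> hcvg dot un f ->
  [/\ cl2cvg L (fun n => wDn L 2 (f0 (un n))) (wDn L 2 (f0 f)),
      cl2cvg L (fun n => f1 (un n)) (f1 f),
      cl2cvg L (fun n => wD L (f2 (un n))) (wD L (f2 f)),
      cl2cvg L (fun n => f3 (un n)) (f3 f) &
      ccvg (fun n => f4 (un n)) (f4 f)].
Proof.
move=> Hun Hf uf; have [K K0 coer] := coercive.
pose e n := complex.Re (dot (un n - f) (un n - f)).
have d n := beam_diff (Hun n) Hf.
have Hd n : beam_space L (un n - f) by case: (d n).
have Ke0 : K * e n @[n --> \oo] --> 0.
  apply: cvg0Z.
  have : hnorm dot (un n - f) * hnorm dot (un n - f) @[n --> \oo] --> (0 * 0 : R).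
    exact: cvgM.
  rewrite mulr0 (_ : (fun n => _) = e)//.
  by apply/funext => n; rewrite -expr2 sqr_sqrtr//; exact: (coer _ (Hd n)).1.
have comp b n := (coer _ (Hd n)).2 b.
have sq (b : bool) (un' : nat -> R -> R[i]) u : (forall n, L2 L (un' n)) -> L2 L u ->
   forall wn : nat -> R -> R[i], (forall n, L2 L (wn n)) ->
   (forall n, aeq L (wn n) (fun x => -1 * u x + un' n x)) ->
   (forall n, sqn L (part b \o wn n) <= K * e n) ->
   l2cvg L (fun n => part b \o un' n) (part b \o u).
  move=> sun su wn swn wE wK; apply: cvg0_le Ke0 => n; rewrite sqn_ge0/=.
  apply: le_trans (wK n); rewrite le_eqVlt; apply/orP; left; apply/eqP.
  apply: sqn_ae.
  - apply: sqintB; [by move/L2P : (sun n); exact|by move/L2P : su; exact].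
  - by move/L2P : (swn n); exact.
  - have /aeqP/(_ b) := wE n; apply: filterS => x h xL; rewrite h//=.
    by rewrite partD mulN1r partN addrC.
have [q0 [_ t0 _] t1 [_ t2 _] t3] := beam_spaceE Hf.
have P n := beam_spaceE (Hun n).
have Q n := beam_spaceE (Hd n).
have subE (u v w : R -> R[i]) : w = (fun x => u x - v x) ->
    aeq L w (fun x => -1 * v x + u x).
  by move=> ->; apply: eq_aeq => x _; ring.
split.
- move=> b; apply: (sq b (fun n => wDn L 2 (f0 (un n)))
    _ _ t0 (fun n => wDn L 2 (f0 (un n - f)))) => n.
  + by have [_ [_ h _] _ _ _] := P n; exact: h.
  + by have [_ [_ h _] _ _ _] := Q n; exact: h.
  + by have [_ h _] := d n; exact: h.
  + by have [h _ _ _ _] := comp b n; exact: h.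
- move=> b; apply: (sq b (fun n => f1 (un n)) _ _ t1 (fun n => f1 (un n - f))) => n.
  + by have [_ _ h _ _] := P n; exact: h.
  + by have [_ _ h _ _] := Q n; exact: h.
  + by have [_ h _ _ _] := state_subE (un n) f; exact: subE.
  + by have [_ h _ _ _] := comp b n; exact: h.
- move=> b; apply: (sq b (fun n => wD L (f2 (un n)))
    _ _ t2 (fun n => wD L (f2 (un n - f)))) => n.
  + by have [_ _ _ [_ h _] _] := P n; exact: h.
  + by have [_ _ _ [_ h _] _] := Q n; exact: h.
  + by have [_ _ h] := d n; exact: h.
  + by have [_ _ h _ _] := comp b n; exact: h.
- move=> b; apply: (sq b (fun n => f3 (un n)) _ _ t3 (fun n => f3 (un n - f))) => n.
  + by have [_ _ _ _ h] := P n; exact: h.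
  + by have [_ _ _ _ h] := Q n; exact: h.
  + by have [_ _ _ h _] := state_subE (un n) f; exact: subE.
  + by have [_ _ _ h _] := comp b n; exact: h.
- move=> b; apply/subr_cvg0; apply: cvg0_sqr_le Ke0 => n.
  have [_ _ _ _] := comp b n; rewrite -/(e n).
  by have [_ _ _ _ ->] := state_subE (un n) f; rewrite partD partN.
Qed.

End Beam.

(** * Closedness of the beam operator *)

Section BeamClosed.
Context {R : realType}.
Notation mu := (@lebesgue_measure R).
Variables (L m J S E G Cp Res k1 k2 CI CD : R).
Hypotheses (L_gt0 : 0 < L) (E_gt0 : 0 < E) (G_gt0 : 0 < G) (Cp_gt0 : 0 < Cp) (S_gt0 : 0 < S)
  (D_gt0 : 0 < m * J - S ^+ 2) (Sm : S < m) (SJ : S < J).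
Implicit Types (f g : state R) (u v w : R -> R[i]).

Notation dot := (beam_dot L m J S E G Cp).
Notation domA := (beam_dom L E G k1 k2 CI).
Notation A := (beam_op L m J S E G Cp Res CD).
Notation D := (m * J - S ^+ 2).
Let i : R[i] := Complex 0 1.

Lemma dom_primitives f : domA f ->
  [/\ primitive L (wDn L 2 (f0 f)) (trace L (wDn L 2 (f0 f)) 0) (wDn L 3 (f0 f)),
      primitive L (wDn L 3 (f0 f)) (trace L (wDn L 3 (f0 f)) 0) (wDn L 4 (f0 f)) &
      primitive L (wD L (f2 f)) (trace L (wD L (f2 f)) 0) (wDn L 2 (f2 f))] /\
  [/\ primitive L (f1 f) 0 (wD L (f1 f)), primitive L (wD L (f1 f)) 0 (wDn L 2 (f1 f)) &
      primitive L (f3 f) 0 (wD L (f3 f))].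
Proof.
move=> [_ [h0 h1 h2 h3] [t1 t1' t3] _].
have [_ {}h0] := sobolevS L_gt0 h0; have [_ {}h0] := sobolevS L_gt0 h0.
have [p02 {}h0] := sobolevS L_gt0 h0; have [p03 _] := sobolevS L_gt0 h0.
have [p10 {}h1] := sobolevS L_gt0 h1; have [p11 _] := sobolevS L_gt0 h1.
have [_ {}h2] := sobolevS L_gt0 h2; have [p21 _] := sobolevS L_gt0 h2.
have [p30 _] := sobolevS L_gt0 h3.
rewrite t1 in p10; rewrite t1' in p11; rewrite t3 in p30.
split; split; [exact: p02|exact: p03|exact: p21|exact: p10|exact: p11|exact: p30].
Qed.

Lemma op_space f : domA f -> [/\ beam_space L (A f),
  aeq L (wDn L 2 (f0 (A f))) (fun x => - i * wDn L 2 (f1 f) x) &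
  aeq L (wD L (f2 (A f))) (fun x => - i * wD L (f3 f) x)].
Proof.
move=> df; have [[_ [_ s4 _] [_ s2 _]] [p10 p11 p30]] := dom_primitives df.
have q0 := primitiveZ (- i) L_gt0 p10; have q1 := primitiveZ (- i) L_gt0 p11.
have q3 := primitiveZ (- i) L_gt0 p30.
rewrite mulr0 in q0; rewrite mulr0 in q1; rewrite mulr0 in q3.
split.
- apply: (beam_space_intro (f := A f) L_gt0 q0 q1 _ q3).
    by apply: L2_lin => //; exact: L2Z.
  rewrite (_ : f3 (A f) = (fun x => - i * (E * S / D)%:C%C * wDn L 4 (f0 f) x
      + - (i * (G * m / D)%:C%C) * wDn L 2 (f2 f) x)).
    by apply: L2_lin => //; exact: L2Z.
  by apply/funext => x; rewrite [X in _ = _ + X]mulNr.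
- rewrite (_ : f0 (A f) = (fun x => - i * f1 f x)); last by reflexivity.
  by have [_ h] := wD2P L_gt0 q0 q1; exact: (aeq_sym h).
- rewrite (_ : f2 (A f) = (fun x => - i * f3 f x)); last by reflexivity.
  by have [_ h] := wDP L_gt0 q3; exact: (aeq_sym h).
Qed.

(** Inverts the linear system that expresses the second and fourth components of
    [A f] by [f0''''] and [f2'']. *)
Lemma op_solve f x :
  - i * (E^-1)%:C%C * (m%:C%C * f1 (A f) x + S%:C%C * f3 (A f) x) = wDn L 4 (f0 f) x /\
  i * (G^-1)%:C%C * (J%:C%C * f3 (A f) x + S%:C%C * f1 (A f) x) = wDn L 2 (f2 f) x.
Proof.
have -> : f1 (A f) x = i * (E * J / D)%:C%C * wDn L 4 (f0 f) x
    + i * (G * S / D)%:C%C * wDn L 2 (f2 f) x by reflexivity.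
have -> : f3 (A f) x = - i * (E * S / D)%:C%C * wDn L 4 (f0 f) x
    - i * (G * m / D)%:C%C * wDn L 2 (f2 f) x by reflexivity.
move: (wDn L 4 (f0 f) x) (wDn L 2 (f2 f) x) => [a b] [c d].
have D0 : D != 0 by rewrite gt_eqF.
have E0 : E != 0 by rewrite gt_eqF.
have G0 : G != 0 by rewrite gt_eqF.
by split; apply: part_eq => -[] /=; field; rewrite ?D0 ?E0 ?G0.
Qed.

(** Only the combinations of derivatives that occur in the norms of [u_n] and
    [A u_n] converge by hypothesis.  The other derivatives, in particular [f0'''],
    are reached by integration: the condition [f0'''(L) = 0] fixes the constant
    in front of the integral of [f0'''']. *)
Lemma beam_op_closed : closed_operator (beam_space L) (beam_eq L) dot domA A.
Proof.
move=> un f g dun Hf Hg uf ug.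
have Hun n : beam_space L (un n) by case: (dun n).
have P n := dom_primitives (dun n).
have Q n := op_space (dun n).
have HA n : beam_space L (A (un n)) by case: (Q n).
have [c0 c1 c2 c3 c4] := hcvg_components L_gt0 S_gt0 E_gt0 G_gt0 Cp_gt0 Sm SJ Hun Hf uf.
have [d0 d1 d2 d3 d4] := hcvg_components L_gt0 S_gt0 E_gt0 G_gt0 Cp_gt0 Sm SJ HA Hg ug.
have [F0 F1 s1f F2 s3f] := beam_spaceE L_gt0 Hf.
have [g0 g1' s1g g2 s3g] := beam_spaceE L_gt0 Hg.
have [_ sf2 _] := F1; have [_ sg2 _] := g1'; have [_ sf2' _] := F2; have [_ sg2' _] := g2.
have sA1 n : L2 L (f1 (A (un n))) by have [_ _ h _ _] := beam_spaceE L_gt0 (HA n); exact: h.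
have sA3 n : L2 L (f3 (A (un n))) by have [_ _ _ _ h] := beam_spaceE L_gt0 (HA n); exact: h.
have LL : 0 <= L <= L by rewrite lexx ltW.
(* The right-hand sides of [op_solve] at the limit. *)
pose p x := - i * (E^-1)%:C%C * (m%:C%C * f1 g x + S%:C%C * f3 g x).
pose q x := i * (G^-1)%:C%C * (J%:C%C * f3 g x + S%:C%C * f1 g x).
have s4 n : L2 L (wDn L 4 (f0 (un n))) by have [[_ [_ h _] _] _] := P n; exact: h.
have s22 n : L2 L (wDn L 2 (f2 (un n))) by have [[_ _ [_ h _]] _] := P n; exact: h.
have sp : L2 L p by apply: L2Z; apply: L2_lin; [by []|exact: L2Z].
have sq : L2 L q by apply: L2Z; apply: L2_lin; [by []|exact: L2Z].
have c4p : cl2cvg L (fun n => wDn L 4 (f0 (un n))) p.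
  have h : cl2cvg L (fun n x => - i * (E^-1)%:C%C *
      (m%:C%C * f1 (A (un n)) x + S%:C%C * f3 (A (un n)) x)) p.
    apply: cl2cvgZ.
    - by move=> n; apply: L2_lin; [exact: sA1|apply: L2Z; exact: sA3].
    - by apply: L2_lin; [exact: s1g|apply: L2Z; exact: s3g].
    - apply: cl2cvg_lin; [exact: sA1|by move=> n; apply: L2Z; exact: sA3|exact: s1g|
        by apply: L2Z; exact: s3g|exact: d1|].
      by apply: cl2cvgZ; [exact: sA3|exact: s3g|exact: d3].
  rewrite (_ : (fun n => wDn L 4 (f0 (un n))) = (fun n x => - i * (E^-1)%:C%C *
      (m%:C%C * f1 (A (un n)) x + S%:C%C * f3 (A (un n)) x))); first exact: h.
  by apply/funext => n; apply/funext => x; have [-> _] := op_solve (un n) x.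
have c22 : cl2cvg L (fun n => wDn L 2 (f2 (un n))) q.
  have h : cl2cvg L (fun n x => i * (G^-1)%:C%C *
      (J%:C%C * f3 (A (un n)) x + S%:C%C * f1 (A (un n)) x)) q.
    apply: cl2cvgZ.
    - by move=> n; apply: L2_lin; [exact: sA3|apply: L2Z; exact: sA1].
    - by apply: L2_lin; [exact: s3g|apply: L2Z; exact: s1g].
    - apply: cl2cvg_lin; [exact: sA3|by move=> n; apply: L2Z; exact: sA1|exact: s3g|
        by apply: L2Z; exact: s1g|exact: d3|].
      by apply: cl2cvgZ; [exact: sA1|exact: s1g|exact: d1].
  rewrite (_ : (fun n => wDn L 2 (f2 (un n))) = (fun n x => i * (G^-1)%:C%C *
      (J%:C%C * f3 (A (un n)) x + S%:C%C * f1 (A (un n)) x))); first exact: h.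
  by apply/funext => n; apply/funext => x; have [_ ->] := op_solve (un n) x.
have s11 n : L2 L (wDn L 2 (f1 (un n))) by have [_ [_ [_ h _] _]] := P n; exact: h.
have s31 n : L2 L (wD L (f3 (un n))) by have [_ [_ _ [_ h _]]] := P n; exact: h.
have iK (z : R[i]) : i * (- i * z) = z by case: z => a b; apply: part_eq => -[] /=; ring.
have c11 : cl2cvg L (fun n => wDn L 2 (f1 (un n))) (fun x => i * wDn L 2 (f0 g) x).
  have sd n : L2 L (wDn L 2 (f0 (A (un n)))).
    by have [_ [_ h _] _ _ _] := beam_spaceE L_gt0 (HA n); exact: h.
  apply: (cl2cvg_ae _ s11 _ _ _ (aeq_refl L _) (cl2cvgZ i sd sg2 d0)).
  - by move=> n; exact: (L2Z i (sd n)).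
  - exact: (L2Z i sg2).
  - exact: (L2Z i sg2).
  - move=> n; have [_ h _] := Q n; apply: filterS h => x h xL.
    by rewrite h// iK.
have c31 : cl2cvg L (fun n => wD L (f3 (un n))) (fun x => i * wD L (f2 g) x).
  have sd n : L2 L (wD L (f2 (A (un n)))).
    by have [_ _ _ [_ h _] _] := beam_spaceE L_gt0 (HA n); exact: h.
  apply: (cl2cvg_ae _ s31 _ _ _ (aeq_refl L _) (cl2cvgZ i sd sg2' d2)).
  - by move=> n; exact: (L2Z i (sd n)).
  - exact: (L2Z i sg2').
  - exact: (L2Z i sg2').
  - move=> n; have [_ _ h] := Q n; apply: filterS h => x h xL.
    by rewrite h// iK.
(* [- i f1''] tends to the second derivative of [f0 g]; integrating twice from 0
   identifies the limit of [f1] with [i f0 g]. *)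
have ig1 := primitiveZ i L_gt0 g1'; have ig0 := primitiveZ i L_gt0 g0.
have ig2 := primitiveZ i L_gt0 g2.
rewrite mulr0 in ig1; rewrite mulr0 in ig0; rewrite mulr0 in ig2.
have z0 : ccvg (fun=> 0) (0 : R[i]) by exact: ccvg_cst.
have p10 n : primitive L (f1 (un n)) 0 (wD L (f1 (un n))).
  by have [_ [h _ _]] := P n; exact: h.
have p11 n : primitive L (wD L (f1 (un n))) 0 (wDn L 2 (f1 (un n))).
  by have [_ [_ h _]] := P n; exact: h.
have p30 n : primitive L (f3 (un n)) 0 (wD L (f3 (un n))).
  by have [_ [_ _ h]] := P n; exact: h.
have [_ si1 _] := ig0.
have cw1 : cl2cvg L (fun n => wD L (f1 (un n))) (fun x => i * wD L (f0 g) x).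
  have h := cl2cvg_primitive L_gt0 p11 z0 (L2Z i sg2) c11.
  apply: (cl2cvg_ae _ _ (L2_prim 0 L_gt0 (L2Z i sg2)) si1 (fun n => aeq_refl L _) _ h).
  - by move=> n; have [_ [_ [k _ _] _]] := P n; exact: k.
  - by move=> n; have [_ [_ [k _ _] _]] := P n; exact: k.
  - by have [_ _ k] := ig1; exact: aeq_sym k.
have f1g : aeq L (f1 f) (fun x => i * f0 g x).
  have h := cl2cvg_primitive L_gt0 p10 z0 si1 cw1.
  have k : aeq L (f1 f) (fun x => 0 + cintegral x (fun x => i * wD L (f0 g) x)).
    apply: (cl2cvg_uniq _ s1f _ c1 h); last exact: L2_prim.
    by move=> n; have [_ [[k _ _] _ _]] := P n; exact: k.
  by have [_ _ k'] := ig0; exact: aeq_trans k (aeq_sym k').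
have f10 : primitive L (f1 f) 0 (fun x => i * wD L (f0 g) x).
  exact: primitive_ae L_gt0 s1f si1 (aeq_sym f1g) (aeq_refl L _) ig0.
(* Likewise [- i f3'] tends to the derivative of [f2 g]. *)
have [_ si3 _] := ig2.
have f3g : aeq L (f3 f) (fun x => i * f2 g x).
  have h := cl2cvg_primitive L_gt0 p30 z0 si3 c31.
  have k : aeq L (f3 f) (fun x => 0 + cintegral x (fun x => i * wD L (f2 g) x)).
    apply: (cl2cvg_uniq _ s3f _ c3 h); last exact: L2_prim.
    by move=> n; have [_ [_ _ [k _ _]]] := P n; exact: k.
  by have [_ _ k'] := ig2; exact: aeq_trans k (aeq_sym k').
have f30 : primitive L (f3 f) 0 (fun x => i * wD L (f2 g) x).
  exact: primitive_ae L_gt0 s3f si3 (aeq_sym f3g) (aeq_refl L _) ig2.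
have p21 n : primitive L (wD L (f2 (un n))) (trace L (wD L (f2 (un n))) 0)
    (wDn L 2 (f2 (un n))).
  by have [[_ _ h] _] := P n; exact: h.
have [t2 [F2q t2cvg]] := primitive_closed L_gt0 p21 sf2' sq c2 c22.
have [_ e22] := wD2P L_gt0 F2 F2q.
have p02 n : primitive L (wDn L 2 (f0 (un n))) (trace L (wDn L 2 (f0 (un n))) 0)
    (wDn L 3 (f0 (un n))).
  by have [[h _ _] _] := P n; exact: h.
have p03 n : primitive L (wDn L 3 (f0 (un n))) (trace L (wDn L 3 (f0 (un n))) 0)
    (wDn L 4 (f0 (un n))).
  by have [[_ h _] _] := P n; exact: h.
(* The value at 0 of the third derivative of the limit, forced by its vanishing
   at [L]. *)
pose t3 := -1 * cintegral L p.
have ct3 : ccvg (fun n => trace L (wDn L 3 (f0 (un n))) 0) t3.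
  rewrite (_ : (fun n => _) = (fun n => -1 * cintegral L (wDn L 4 (f0 (un n))))).
    by apply: ccvgZ; exact: ccvg_cintegral LL s4 sp c4p.
  apply/funext => n; have [_ _ _ [t30 _ _]] := dun n.
  have tE := trace_primitive L_gt0 LL (p03 n).
  by rewrite t30 in tE; rewrite mulN1r; apply/eqP; rewrite -addr_eq0 -tE.
pose r x := t3 + cintegral x p.
have pr : primitive L r t3 p := primitive_self t3 L_gt0 sp.
have [sr _ _] := pr.
have c3p : cl2cvg L (fun n => wDn L 3 (f0 (un n))) r.
  exact: cl2cvg_primitive L_gt0 p03 ct3 sp c4p.
have [t2' [F02 t02cvg]] := primitive_closed L_gt0 p02 sf2 sr c0 c3p.
have [[_ sw3 _] e3] := wDP L_gt0 F02.
have [_ e4] := wD2P L_gt0 F02 pr.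
have F3 : primitive L (wDn L 3 (f0 f)) t3 p.
  exact: primitive_ae L_gt0 sw3 sp e3 (aeq_refl L p) pr.
have [[_ sw1 _] ew1] := wDP L_gt0 f10.
have F11 : primitive L (wD L (f1 f)) 0 (fun x => i * wDn L 2 (f0 g) x).
  exact: primitive_ae L_gt0 sw1 (L2Z i sg2) ew1 (aeq_refl L _) ig1.
have tr02 : ccvg (fun n => trace L (wDn L 2 (f0 (un n))) L) (trace L (wDn L 2 (f0 f)) L).
  exact: trace_ccvg L_gt0 LL p02 F02 (t02cvg L LL).
have tr11 : ccvg (fun n => trace L (wD L (f1 (un n))) L) (trace L (wD L (f1 f)) L).
  apply: (trace_ccvg L_gt0 LL p11 F11).
  by apply: ccvgD; [exact: z0|exact: ccvg_cintegral LL s11 (L2Z i sg2) c11].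
have tr21 : ccvg (fun n => trace L (wD L (f2 (un n))) L) (trace L (wD L (f2 f)) L).
  exact: trace_ccvg L_gt0 LL p21 F2q (t2cvg L LL).
have tr30 : ccvg (fun n => trace L (f3 (un n)) L) (trace L (f3 f) L).
  apply: (trace_ccvg L_gt0 LL p30 f30).
  by apply: ccvgD; [exact: z0|exact: ccvg_cintegral LL s31 (L2Z i sg2') c31].
have sob0 w : L2 L w -> sobolev L 0 w by [].
have smooth : [/\ sobolev L 4 (f0 f), sobolev L 2 (f1 f), sobolev L 2 (f2 f) &
    sobolev L 1 (f3 f)].
  split.
  - apply: (primitive_sobolev L_gt0 F0); apply: (primitive_sobolev L_gt0 F1).
    apply: (primitive_sobolev L_gt0 F02); apply: (primitive_sobolev L_gt0 pr).
    exact: sob0 sp.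
  - apply: (primitive_sobolev L_gt0 f10); apply: (primitive_sobolev L_gt0 ig1).
    exact: sob0 (L2Z i sg2).
  - apply: (primitive_sobolev L_gt0 F2); apply: (primitive_sobolev L_gt0 F2q).
    exact: sob0 sq.
  - by apply: (primitive_sobolev L_gt0 f30); exact: sob0 si3.
have D0 : D != 0 by rewrite gt_eqF.
have E0 : E != 0 by rewrite gt_eqF.
have G0 : G != 0 by rewrite gt_eqF.
split.
- split; [exact: Hf|exact: smooth| |].
    split; [exact: (trace0_primitive L_gt0 f10)|exact: (trace0_primitive L_gt0 F11)|
      exact: (trace0_primitive L_gt0 f30)].
  split.
  + by rewrite (trace_primitive L_gt0 LL F3) /t3 mulN1r addNr.
  + have h := ccvgD (ccvgD (ccvgZ (a := E%:C%C) tr02) (ccvgZ (a := k1%:C%C) tr11))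
      (ccvgZ (a := CI%:C%C) c4).
    apply: (ccvg_uniq h); rewrite (_ : (fun n => _) = (fun=> 0)); first exact: z0.
    by apply/funext => n; have [_ _ _ [_ h' _]] := dun n; exact: h'.
  + have h := ccvgD (ccvgZ (a := G%:C%C) tr21) (ccvgZ (a := k2%:C%C) tr30).
    apply: (ccvg_uniq h); rewrite (_ : (fun n => _) = (fun=> 0)); first exact: z0.
    by apply/funext => n; have [_ _ _ [_ _ h']] := dun n; exact: h'.
- have iK' (z : R[i]) : - i * (i * z) = z by case: z => a b; apply: part_eq => -[] /=; ring.
  split.
  + apply: filterS f1g => x h xL; rewrite (_ : f0 (A f) x = - i * f1 f x); last by reflexivity.
    by rewrite h// iK'.
  + apply: filterS2 e4 e22 => x h4 h2 xL.
    rewrite (_ : f1 (A f) x = i * (E * J / D)%:C%C * wDn L 4 (f0 f) x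
      + i * (G * S / D)%:C%C * wDn L 2 (f2 f) x); last by reflexivity.
    rewrite -[wDn L 4 (f0 f) x](h4 xL) -[wDn L 2 (f2 f) x](h2 xL) /p /q.
    move: (f1 g x) (f3 g x) => [a b] [c d].
    by apply: part_eq => -[] /=; field; rewrite ?D0 ?E0 ?G0.
  + apply: filterS f3g => x h xL; rewrite (_ : f2 (A f) x = - i * f3 f x); last by reflexivity.
    by rewrite h// iK'.
  + apply: filterS2 e4 e22 => x h4 h2 xL.
    rewrite (_ : f3 (A f) x = - i * (E * S / D)%:C%C * wDn L 4 (f0 f) x
      - i * (G * m / D)%:C%C * wDn L 2 (f2 f) x); last by reflexivity.
    rewrite -[wDn L 4 (f0 f) x](h4 xL) -[wDn L 2 (f2 f) x](h2 xL) /p /q.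
    move: (f1 g x) (f3 g x) => [a b] [c d].
    by apply: part_eq => -[] /=; field; rewrite ?D0 ?E0 ?G0.
  + apply: (ccvg_uniq _ d4).
    exact: ccvgD (ccvgZ (a := i * (CD / Cp)%:C%C) tr11) (ccvgZ (a := i * (1 / (Cp * Res))%:C%C) c4).
Qed.

End BeamClosed.

(** * Unboundedness and lack of self-adjointness *)

Section Examples.
Context {R : realType}.
Notation mu := (@lebesgue_measure R).
Lemma primitive_derive (L : R) (F F' : R -> R) : 0 < L ->
  (forall t : R, is_derive t (1 : R) F (F' t)) -> continuous F' ->
  primitive L (fun x => (F x)%:C%C) (F 0)%:C%C (fun x => (F' x)%:C%C).
Proof.
move=> L0 dF cF'.
have cF : continuous F.
  move=> t; apply: differentiable_continuous; apply/derivable1_diffP.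
  by case: (dF t).
have sc (u : R -> R) : continuous u -> L2 L (fun x => (u x)%:C%C).
  move=> cu; apply/L2P => -[] /=; first exact/sqint_cont/continuous_subspaceT.
  exact: sqint_cst.
split; [exact: sc|exact: sc|apply: eq_aeq => x].
rewrite /= in_itv/= => /andP[x0 xL]; apply: part_eq => b.
rewrite partD part_cintegral; case: b; first exact: rint_derive.
by rewrite [rint _ _]rint_zero addr0.
Qed.

Lemma primitive_zero (L : R) : 0 < L -> @primitive R L (fun=> 0) 0 (fun=> 0).
Proof.
by move=> L0; apply: (@primitive_derive _ (fun=> 0) (fun=> 0)) => // t; exact: cvg_cst.
Qed.

(** The inner product of L^2; written out for [beam_dot], it lets components be
    replaced by almost everywhere equal ones. *)
Definition pairing (L : R) (u v : R -> R[i]) : R[i] :=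
  cintegral L (fun x => u x * conjc (v x)).

Lemma integ_pairing (L : R) (u v : R -> R[i]) b : L2 L u -> L2 L v ->
  integ L (fun x => part b (u x * conjc (v x))).
Proof.
move=> /L2P su /L2P sv; case: b.
  rewrite (_ : (fun x => _) = (fun x => (part true \o u) x * (part true \o v) x
      + (part false \o u) x * (part false \o v) x)).
    by apply: integD; apply: sqint_mul.
  by apply/funext => x /=; case: (u x) (v x) => [a b] [c d] /=; ring.
rewrite (_ : (fun x => _) = (fun x => (part false \o u) x * (part true \o v) x
    - (part true \o u) x * (part false \o v) x)).
  by apply: integB; apply: sqint_mul.
by apply/funext => x /=; case: (u x) (v x) => [a b] [c d] /=; ring.
Qed.

Lemma pairing_ae (L : R) (u u' v v' : R -> R[i]) : L2 L u -> L2 L u' -> L2 L v -> L2 L v' ->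
  aeq L u u' -> aeq L v v' -> pairing L u v = pairing L u' v'.
Proof.
move=> su su' sv sv' uu' vv'; apply: part_eq => b; rewrite !part_cintegral.
apply: rint_ae; [exact: integ_meas (integ_pairing b su sv)|
  exact: integ_meas (integ_pairing b su' sv')|].
by apply: filterS2 uu' vv' => x h1 h2 xL /=; rewrite h1// h2.
Qed.

Lemma pairing0l (L : R) (v : R -> R[i]) : pairing L (fun=> 0) v = 0.
Proof.
apply: part_eq => b; rewrite part_cintegral part0.
rewrite (@eq_rint _ _ _ (fun=> 0)); last by move=> x _; rewrite /= mul0r part0.
exact: rint_zero.
Qed.

Lemma pairing0r (L : R) (v : R -> R[i]) : pairing L v (fun=> 0) = 0.
Proof.
apply: part_eq => b; rewrite part_cintegral part0.
rewrite (@eq_rint _ _ _ (fun=> 0)); last first.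
  by move=> x _ /=; case: (v x) b => [a c] [] /=; ring.
exact: rint_zero.
Qed.

Variables (L m J S E G Cp Res k1 k2 CI CD : R).
Hypotheses (L_gt0 : 0 < L) (J_gt0 : 0 < J) (E_gt0 : 0 < E) (G_gt0 : 0 < G) (Cp_gt0 : 0 < Cp)
  (Res_gt0 : 0 < Res).
Notation dot := (beam_dot L m J S E G Cp).
Notation domA := (beam_dom L E G k1 k2 CI).
Notation A := (beam_op L m J S E G Cp Res CD).
Implicit Types f g : state R.

Lemma cintegral_form (u0 u1 u2 u3 v0 v1 v2 v3 : R -> R[i]) :
  L2 L u0 -> L2 L u1 -> L2 L u2 -> L2 L u3 ->
  L2 L v0 -> L2 L v1 -> L2 L v2 -> L2 L v3 ->
  cintegral L (fun x => E%:C%C * u0 x * conjc (v0 x) + m%:C%C * u1 x * conjc (v1 x)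
    + G%:C%C * u2 x * conjc (v2 x) + J%:C%C * u3 x * conjc (v3 x)
    + S%:C%C * (u1 x * conjc (v3 x) + u3 x * conjc (v1 x))) =
  E%:C%C * pairing L u0 v0 + m%:C%C * pairing L u1 v1 + G%:C%C * pairing L u2 v2
    + J%:C%C * pairing L u3 v3 + S%:C%C * (pairing L u1 v3 + pairing L u3 v1).
Proof.
move=> s0 s1 s2 s3 t0 t1 t2 t3; apply: part_eq => b.
have CM (r : R) (z : R[i]) : part b (r%:C%C * z) = r * part b z.
  by case: (b) z => -[x y] /=; ring.
rewrite !partD !CM !partD !part_cintegral.
have iE := integ_pairing b s0 t0; have im := integ_pairing b s1 t1.
have iG := integ_pairing b s2 t2; have iJ := integ_pairing b s3 t3.
have i13 := integ_pairing b s1 t3; have i31 := integ_pairing b s3 t1.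
have i5 := integZ S (integD i13 i31).
have iE' := integZ E iE; have im' := integZ m im.
have iG' := integZ G iG; have iJ' := integZ J iJ.
rewrite -(rintZ _ iE) -(rintZ _ im) -(rintZ _ iG) -(rintZ _ iJ).
rewrite -(rintD i13 i31) -(rintZ _ (integD i13 i31)).
rewrite -(rintD iE' im') -(rintD (integD iE' im') iG').
rewrite -(rintD (integD (integD iE' im') iG') iJ').
rewrite -(rintD (integD (integD (integD iE' im') iG') iJ') i5).
by apply: eq_rint => x _ /=; rewrite !partD -!mulrA !CM !partD.
Qed.

Lemma dot_pairing f g : beam_space L f -> beam_space L g ->
  dot f g = (2^-1)%:C%C * (E%:C%C * pairing L (wDn L 2 (f0 f)) (wDn L 2 (f0 g))
    + m%:C%C * pairing L (f1 f) (f1 g) + G%:C%C * pairing L (wD L (f2 f)) (wD L (f2 g))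
    + J%:C%C * pairing L (f3 f) (f3 g)
    + S%:C%C * (pairing L (f1 f) (f3 g) + pairing L (f3 f) (f1 g)))
  + (2^-1)%:C%C * Cp%:C%C * f4 f * conjc (f4 g).
Proof.
move=> /(beam_spaceE L_gt0)[_ [_ s0 _] s1 [_ s2 _] s3].
move=> /(beam_spaceE L_gt0)[_ [_ t0 _] t1 [_ t2 _] t3].
by rewrite /beam_dot (cintegral_form s0 s1 s2 s3 t0 t1 t2 t3).
Qed.

Lemma null_primitive u : L2 L u -> aeq L (fun=> 0) u -> primitive L u 0 (fun=> 0).
Proof.
move=> su u0; have Z := primitive_zero L_gt0; have [_ s0 _] := Z.
exact: primitive_ae L_gt0 su s0 u0 (aeq_refl L _) Z.
Qed.

Lemma null_trace u x : 0 <= x <= L -> L2 L u -> aeq L (fun=> 0) u -> trace L u x = 0.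
Proof.
move=> xL su u0.
have c0 b : {within `[0, L], continuous (part b \o (fun=> 0 : R[i]))}.
  by apply: continuous_subspaceT => t; exact: cvg_cst.
exact: trace_cont L_gt0 xL c0 (aeq_sym u0).
Qed.

Lemma wDn_null k u : L2 L u -> aeq L (fun=> 0) u ->
  L2 L (wDn L k u) /\ aeq L (fun=> 0) (wDn L k u).
Proof.
move=> su u0; elim: k => [|k [sk k0]]; first by split.
have [[_ h _] h'] := wDP L_gt0 (null_primitive sk k0).
by split; [exact: h|exact: h'].
Qed.

Lemma sobolev_null k u : L2 L u -> aeq L (fun=> 0) u -> sobolev L k u.
Proof.
move=> su u0; elim: k u su u0 => [//|k IH] u su u0.
apply: (primitive_sobolev L_gt0 (null_primitive su u0)).
by apply: IH; [exact: L2_cst|exact: aeq_refl].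
Qed.

(** Records which functions represent, up to null sets, the four components of
    [f] that enter the inner product. *)
Definition profile f (u0 u1 u2 u3 : R -> R[i]) := [/\ beam_space L f,
  [/\ L2 L u0, L2 L u1, L2 L u2 & L2 L u3] &
  [/\ aeq L u0 (wDn L 2 (f0 f)), aeq L u1 (f1 f), aeq L u2 (wD L (f2 f)) &
      aeq L u3 (f3 f)]].

Lemma dot_profile f g (u0 u1 u2 u3 v0 v1 v2 v3 : R -> R[i]) :
  profile f u0 u1 u2 u3 -> profile g v0 v1 v2 v3 ->
  dot f g = (2^-1)%:C%C * (E%:C%C * pairing L u0 v0 + m%:C%C * pairing L u1 v1
    + G%:C%C * pairing L u2 v2 + J%:C%C * pairing L u3 v3
    + S%:C%C * (pairing L u1 v3 + pairing L u3 v1))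
  + (2^-1)%:C%C * Cp%:C%C * f4 f * conjc (f4 g).
Proof.
move=> [Hf [su0 su1 su2 su3] [e0 e1 e2 e3]] [Hg [sv0 sv1 sv2 sv3] [d0 d1 d2 d3]].
rewrite (dot_pairing Hf Hg).
have [_ [_ s0 _] s1 [_ s2 _] s3] := beam_spaceE L_gt0 Hf.
have [_ [_ t0 _] t1 [_ t2 _] t3] := beam_spaceE L_gt0 Hg.
rewrite (pairing_ae su0 s0 sv0 t0 e0 d0) (pairing_ae su1 s1 sv1 t1 e1 d1).
rewrite (pairing_ae su2 s2 sv2 t2 e2 d2) (pairing_ae su3 s3 sv3 t3 e3 d3).
by rewrite (pairing_ae su1 s1 sv3 t3 e1 d3) (pairing_ae su3 s3 sv1 t1 e3 d1).
Qed.

Lemma op_profile f (w3 : R -> R[i]) : domA f -> L2 L w3 ->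
  aeq L (fun=> 0) (wDn L 2 (f1 f)) -> aeq L (fun=> 0) (wDn L 4 (f0 f)) ->
  aeq L (fun=> 0) (wDn L 2 (f2 f)) -> aeq L w3 (wD L (f3 f)) ->
  profile (A f) (fun=> 0) (fun=> 0) (fun x => - Complex 0 1 * w3 x) (fun=> 0).
Proof.
move=> df sw3 h1 h0 h2 h3; have [HA e0 e2] := op_space m J S Cp Res CD L_gt0 df.
split; first exact: HA.
  by split; [exact: L2_cst|exact: L2_cst|exact: L2Z|exact: L2_cst].
split.
- apply: filterS2 e0 h1 => x z0 z1 xL; rewrite (z0 xL) -(z1 xL).
  by rewrite mulr0.
- apply: filterS2 h0 h2 => x z0 z1 xL.
  rewrite (_ : f1 (A f) x = Complex 0 1 * (E * J / (m * J - S ^+ 2))%:C%C * wDn L 4 (f0 f) x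
      + Complex 0 1 * (G * S / (m * J - S ^+ 2))%:C%C * wDn L 2 (f2 f) x); last by reflexivity.
  by rewrite -(z0 xL) -(z1 xL) !mulr0 addr0.
- by apply: filterS2 e2 h3 => x z0 z1 xL; rewrite (z0 xL) -(z1 xL).
- apply: filterS2 h0 h2 => x z0 z1 xL.
  rewrite (_ : f3 (A f) x = - Complex 0 1 * (E * S / (m * J - S ^+ 2))%:C%C * wDn L 4 (f0 f) x
      - Complex 0 1 * (G * m / (m * J - S ^+ 2))%:C%C * wDn L 2 (f2 f) x); last by reflexivity.
  by rewrite -(z0 xL) -(z1 xL) !mulr0 subr0.
Qed.

Section Wave.
Variable n : nat.
Let lam : R := n.+1%:R * pi / L.

Lemma sin_natpi k : sin (k%:R * pi) = 0 :> R.
Proof.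
elim: k => [|k IH]; first by rewrite mul0r sin0.
by rewrite -natr1 mulrDl mul1r sinDpi IH oppr0.
Qed.

Let lam_gt0 : 0 < lam.
Proof. by rewrite divr_gt0// mulr_gt0// pi_gt0. Qed.

Let lamL : sin (lam * L) = 0.
Proof. by rewrite /lam mulfVK ?gt_eqF// sin_natpi. Qed.

Let dlin (x : R) : is_derive x (1 : R) (fun y => lam * y) lam.
Proof.
apply: (@is_derive_quad _ _ _ _ 0) => k.
by rewrite (_ : _ - _ = 0) ?normr0 ?mul0r//; ring.
Qed.

Let dsin (x : R) : is_derive x (1 : R) (fun y => sin (lam * y)) (lam * cos (lam * x)).
Proof.
have := @is_derive1_comp R sin (fun y => lam * y) x _ _ (is_derive_sin _) (dlin x).
by rewrite mulrC.
Qed.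

Let dcos (x : R) : is_derive x (1 : R) (fun y => cos (lam * y)) (- (lam * sin (lam * x))).
Proof.
have := @is_derive1_comp R cos (fun y => lam * y) x _ _ (is_derive_cos _) (dlin x).
by rewrite mulNr mulrC.
Qed.

Let csin : continuous (fun x => sin (lam * x)).
Proof.
move=> x; apply: differentiable_continuous; apply/derivable1_diffP.
by case: (dsin x).
Qed.

Let ccos : continuous (fun x => cos (lam * x)).
Proof.
move=> x; apply: differentiable_continuous; apply/derivable1_diffP.
by case: (dcos x).
Qed.

(** The integrals of [cos^2] and [sin^2] have sum [L], and difference 0 because
    [sin cos] vanishes at both ends. *)
Lemma wave_energy : rint L (fun x => cos (lam * x) ^+ 2) = L / 2 /\
  rint L (fun x => sin (lam * x) ^+ 2) = L / 2.
Proof.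
have ic : integ L (fun x => cos (lam * x) ^+ 2).
  by apply: (sqint_cont (continuous_subspaceT ccos)).2.
have is_ : integ L (fun x => sin (lam * x) ^+ 2).
  by apply: (sqint_cont (continuous_subspaceT csin)).2.
have h1 : rint L (fun x => cos (lam * x) ^+ 2) + rint L (fun x => sin (lam * x) ^+ 2) = L.
  rewrite -rintD// (@eq_rint _ _ _ (fun=> 1)); last by move=> x _; exact: cos2Dsin2.
  by rewrite rint_cst ?mul1r// ltW.
have h2 : rint L (fun x => cos (lam * x) ^+ 2) - rint L (fun x => sin (lam * x) ^+ 2) = 0.
  rewrite -rintB//.
  have cF' : continuous (fun x => lam * (cos (lam * x) ^+ 2 - sin (lam * x) ^+ 2)).
    move=> x; apply: cvgMr; rewrite !expr2.
    rewrite (_ : (fun x => _) = ((fun x => cos (lam * x)) \* (fun x => cos (lam * x))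
      \- (fun x => sin (lam * x)) \* (fun x => sin (lam * x)))); last first.
      by apply/funext => y; rewrite /= !expr2.
    by apply: cvgB; apply: cvgM; (exact: ccos || exact: csin).
  have := @rint_derive R L (fun x => sin (lam * x) * cos (lam * x)) _ _ cF' (ltW L_gt0).
  rewrite lamL mulr0 sin0 !mul0r add0r rintZ; last exact: integB.
  move=> h; apply: (mulfI (lt0r_neq0 lam_gt0)); rewrite mulr0; apply/esym/h => t.
  rewrite (_ : lam * _ = sin (lam * t) *: - (lam * sin (lam * t))
      + cos (lam * t) *: (lam * cos (lam * t))); last by rewrite /GRing.scale/=; ring.
  exact: is_deriveM (dsin t) (dcos t).
by split; lra.
Qed.

Definition wave : state R :=
  (fun=> 0, fun=> 0, fun=> 0, fun x => (sin (lam * x))%:C%C, 0).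

Let sZ : L2 L (fun=> 0 : R[i]). Proof. exact: L2_cst. Qed.
Let eZ : aeq L (fun=> 0 : R[i]) (fun=> 0). Proof. exact: aeq_refl. Qed.
Let pw : primitive L (f3 wave) 0 (fun x => (lam * cos (lam * x))%:C%C).
Proof.
have c : continuous (fun x => lam * cos (lam * x)).
  by move=> x; apply: cvgMr; exact: ccos.
have := @primitive_derive L (fun x => sin (lam * x)) _ L_gt0 dsin c.
by rewrite mulr0 sin0.
Qed.

Lemma wave_space : beam_space L wave.
Proof.
have Z := primitive_zero L_gt0; have [s3 _ _] := pw.
exact: (beam_space_intro (f := wave) L_gt0 Z Z sZ Z s3).
Qed.

Lemma wave_dom : domA wave.
Proof.
have LL : 0 <= L <= L by rewrite lexx ltW.
have L0 : 0 <= (0 : R) <= L by rewrite lexx (ltW L_gt0).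
have N k := wDn_null k sZ eZ.
have t k x : 0 <= x <= L -> trace L (wDn L k (fun=> 0)) x = 0.
  by move=> xL; have [h h'] := N k; exact: null_trace xL h h'.
have [s3 sc _] := pw.
split; first exact: wave_space.
- split; [exact: sobolev_null sZ eZ|exact: sobolev_null sZ eZ|
    exact: sobolev_null sZ eZ|by apply: (primitive_sobolev L_gt0 pw); exact: sc].
- split; [exact: (t 0%N 0 L0)|exact: (t 1%N 0 L0)|exact: trace0_primitive pw].
- have tw : trace L (f3 wave) L = 0.
    have cw b : {within `[0, L], continuous (part b \o f3 wave)}.
      apply: continuous_subspaceT; case: b; first exact: csin.
      by move=> x; exact: cvg_cst.
    rewrite (trace_cont L_gt0 LL cw (aeq_refl L _)).
    rewrite (_ : f3 wave L = (sin (lam * L))%:C%C); last by reflexivity.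
    by rewrite lamL; reflexivity.
  split; first exact: (t 3%N L LL).
    rewrite -[trace L (wDn L 2 (f0 wave)) L]/(trace L (wDn L 2 (fun=> 0)) L).
    rewrite -[trace L (wD L (f1 wave)) L]/(trace L (wDn L 1 (fun=> 0)) L).
    rewrite -[f4 wave]/(0 : R[i]).
    by rewrite (t 2%N L LL) (t 1%N L LL) !mulr0 !addr0.
  rewrite tw -[trace L (wD L (f2 wave)) L]/(trace L (wDn L 1 (fun=> 0)) L).
  by rewrite (t 1%N L LL) !mulr0 addr0.
Qed.

Lemma wave_norms : complex.Re (dot wave wave) = J * L / 4 /\
  complex.Re (dot (A wave) (A wave)) = G * lam ^+ 2 * L / 4.
Proof.
have [s3 sc _] := pw; have N k := wDn_null k sZ eZ.
have P : profile wave (fun=> 0) (fun=> 0) (fun=> 0) (f3 wave).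
  split; first exact: wave_space.
    split; [exact: sZ|exact: sZ|exact: sZ|exact: s3].
  by split; [exact: (N 2%N).2|exact: eZ|exact: (N 1%N).2|exact: aeq_refl].
have Q : profile (A wave) (fun=> 0) (fun=> 0)
    (fun x => - Complex 0 1 * (lam * cos (lam * x))%:C%C) (fun=> 0).
  apply: (op_profile wave_dom sc); [exact: (N 2%N).2|exact: (N 4).2|exact: (N 2%N).2|].
  exact: (wDP L_gt0 pw).2.
have [ic is_] := wave_energy; have LL : 0 <= L <= L by rewrite lexx ltW.
have f4A : f4 (A wave) = 0.
  rewrite (_ : f4 (A wave) = Complex 0 1 * (CD / Cp)%:C%C * trace L (wDn L 1 (fun=> 0)) L
      + Complex 0 1 * (1 / (Cp * Res))%:C%C * 0); last by reflexivity.
  by rewrite (null_trace LL (N 1%N).1 (N 1%N).2) !mulr0 addr0.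
have f4w : f4 wave = 0 by [].
rewrite (dot_profile P P) (dot_profile Q Q) f4A f4w !pairing0l !pairing0r.
rewrite !(mulr0, mul0r, addr0, add0r).
have ReM (r : R) (z : R[i]) : complex.Re (r%:C%C * z) = r * complex.Re z.
  by case: z => a b /=; ring.
rewrite !ReM; split.
  rewrite (_ : complex.Re _ = rint L (fun x => sin (lam * x) ^+ 2)).
    by rewrite is_; field.
  by apply: eq_rint => x _ /=; ring.
rewrite (_ : complex.Re _ = rint L (fun x => lam ^+ 2 * cos (lam * x) ^+ 2)).
  rewrite rintZ; last by apply: (sqint_cont (continuous_subspaceT ccos)).2.
  by rewrite ic; field.
by apply: eq_rint => x _ /=; ring.
Qed.

End Wave.

Lemma beam_op_unbounded : ~ bounded_operator dot domA A.
Proof.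
move=> [M bM].
have key n : G * (n.+1%:R * pi / L) ^+ 2 <= M ^+ 2 * J.
  have := bM _ (wave_dom n); have [e1 e2] := wave_norms n.
  rewrite /hnorm e1 e2; set a := J * L / 4; set b := G * _ * L / 4 => h.
  have L4 : 0 < L / 4 by rewrite divr_gt0.
  have a0 : 0 <= a by rewrite /a -mulrA mulr_ge0// ltW.
  have b0 : 0 <= b by rewrite /b -mulrA mulr_ge0 ?(ltW L4)// mulr_ge0 ?sqr_ge0 ?(ltW G_gt0).
  have : Num.sqrt b ^+ 2 <= (M * Num.sqrt a) ^+ 2.
    by rewrite ler_pXn2r// nnegrE ?sqrtr_ge0// (le_trans (sqrtr_ge0 _) h).
  rewrite exprMn !sqr_sqrtr// /a /b -!mulrA (mulrA M) => h'.
  rewrite -(ler_pM2r L4) -!mulrA (mulrA M); move: h'; rewrite !mulrA; exact.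
have q0 : 0 < G * (pi / L) ^+ 2.
  by rewrite mulr_gt0// exprn_gt0// divr_gt0// pi_gt0.
pose x := M ^+ 2 * J / (G * (pi / L) ^+ 2).
have x0 : 0 <= x by rewrite divr_ge0 ?(ltW q0)// mulr_ge0 ?sqr_ge0// ltW.
have := key (Num.bound x); apply/negP; rewrite -ltNge.
have xK : x < (Num.bound x).+1%:R.
  by apply: lt_trans (archi_boundP x0) _; rewrite ltr_nat.
have -> : G * ((Num.bound x).+1%:R * pi / L) ^+ 2 =
    (Num.bound x).+1%:R ^+ 2 * (G * (pi / L) ^+ 2).
  by rewrite -mulrA exprMn; ring.
rewrite -ltr_pdivrMr//; apply: lt_le_trans xK _.
by rewrite expr2 ler_peMr ?ler0n// ler1n.
Qed.

Definition static : state R :=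
  (fun x => (- CI / (2 * E) * x ^+ 2)%:C%C, fun=> 0, fun=> 0, fun=> 0, 1).

(** The coefficient of [x^2] is chosen so that [E f0''(L) + CI f4 = 0]. *)
Lemma static_profile : domA static /\
  profile static (fun=> (2 * (- CI / (2 * E)))%:C%C) (fun=> 0) (fun=> 0) (fun=> 0) /\
  profile (A static) (fun=> 0) (fun=> 0) (fun=> 0) (fun=> 0).
Proof.
set a := - CI / (2 * E).
have LL : 0 <= L <= L by rewrite lexx ltW.
have L0 : 0 <= (0 : R) <= L by rewrite lexx (ltW L_gt0).
have Z := primitive_zero L_gt0.
have sZ : L2 L (fun=> 0 : R[i]) by exact: L2_cst.
have eZ : aeq L (fun=> 0 : R[i]) (fun=> 0) by exact: aeq_refl.
have N k := wDn_null k sZ eZ.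
have t k x : 0 <= x <= L -> trace L (wDn L k (fun=> 0)) x = 0.
  by move=> xL; have [h h'] := N k; exact: null_trace xL h h'.
have d0 (x : R) : is_derive x (1 : R) (fun y => a * y ^+ 2) (2 * a * x).
  apply: (@is_derive_quad _ _ _ _ `|a|) => k.
  rewrite (_ : _ - _ = a * k ^+ 2); last by ring.
  by rewrite normrM (ger0_norm (sqr_ge0 k)).
have d1 (x : R) : is_derive x (1 : R) (fun y => 2 * a * y) (2 * a).
  apply: (@is_derive_quad _ _ _ _ 0) => k.
  by rewrite (_ : _ - _ = 0) ?normr0 ?mul0r//; ring.
have d2 (x : R) : is_derive x (1 : R) (fun=> 2 * a) 0 by exact: is_derive_cst.
have c1 : continuous (fun x => 2 * a * x).
  by move=> x; apply: cvgMr; exact: cvg_id.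
have c2 : continuous (fun _ : R => 2 * a) by move=> x; exact: cvg_cst.
have c3 : continuous (fun _ : R => 0 : R) by move=> x; exact: cvg_cst.
have p0 : primitive L (f0 static) 0 (fun x => (2 * a * x)%:C%C).
  by have := primitive_derive L_gt0 d0 c1; rewrite expr0n mulr0.
have p1 : primitive L (fun x => (2 * a * x)%:C%C) 0 (fun=> (2 * a)%:C%C).
  by have := primitive_derive L_gt0 d1 c2; rewrite mulr0.
have p2 : primitive L (fun=> (2 * a)%:C%C) (2 * a)%:C%C (fun=> 0).
  exact: primitive_derive L_gt0 d2 c3.
have Hs : beam_space L static.
  exact: (beam_space_intro (f := static) L_gt0 p0 p1 sZ Z sZ).
have [pw2 e2] := wD2P L_gt0 p0 p1; have [_ s2 _] := p1.
have [q2 _] := wD2P L_gt0 p0 p1.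
have [_ sw2 _] := q2.
have p2' : primitive L (wDn L 2 (f0 static)) (2 * a)%:C%C (fun=> 0).
  exact: primitive_ae L_gt0 sw2 sZ e2 (aeq_refl L _) p2.
have [[_ s3 _] e3] := wDP L_gt0 p2'.
have [[_ s4 _] e4] := wDP L_gt0 (null_primitive s3 e3).
have ds : domA static.
  split; first exact: Hs.
  - split; [|exact: sobolev_null sZ eZ|exact: sobolev_null sZ eZ|exact: sobolev_null sZ eZ].
    apply: (primitive_sobolev L_gt0 p0); apply: (primitive_sobolev L_gt0 p1).
    apply: (primitive_sobolev L_gt0 p2); apply: (primitive_sobolev L_gt0 Z).
    exact: sZ.
  - split; [exact: (t 0%N 0 L0)|exact: (t 1%N 0 L0)|exact: (t 0%N 0 L0)].
  - split; first exact: (null_trace LL s3 e3).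
      rewrite -[trace L (wD L (f1 static)) L]/(trace L (wDn L 1 (fun=> 0)) L).
      rewrite -[f4 static]/(1 : R[i]) (t 1%N L LL) (trace_primitive L_gt0 LL p2').
      apply: part_eq => b; rewrite mulr0 addr0 mulr1 partD.
      rewrite cintegral_zero part0 addr0.
      by case: b => /=; rewrite /a; field; rewrite gt_eqF.
    rewrite -[trace L (wD L (f2 static)) L]/(trace L (wDn L 1 (fun=> 0)) L).
    rewrite -[trace L (f3 static) L]/(trace L (wDn L 0 (fun=> 0)) L).
    by rewrite (t 1%N L LL) (t 0%N L LL) !mulr0 addr0.
split; first exact: ds.
split.
  split; first exact: Hs.
    split; [exact: L2_cst|exact: sZ|exact: sZ|exact: sZ].
  by split; [exact: e2|exact: eZ|exact: (N 1%N).2|exact: eZ].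
have [HA h2 [k0 k1' k2' k3']] := op_profile ds sZ (N 2%N).2 e4 (N 2%N).2 (N 1%N).2.
split; [exact: HA|by split|split; [exact: k0|exact: k1'| |exact: k3']].
by apply: filterS k2' => x h xL; rewrite -(h xL) mulr0.
Qed.

Lemma beam_op_not_selfadjoint :
  ~ selfadjoint_operator (beam_space L) (beam_eq L) dot domA A.
Proof.
move=> [_ sa]; have [ds [P Q]] := static_profile.
have [Hs _ _] := P; have [HA _ _] := Q.
have [_ /(_ _)[|_ _ /(_ _ ds)]] := sa _ _ Hs HA.
  by split; [exact: ds|split; [exact: aeq_refl..|by []]].
rewrite (dot_profile P Q) (dot_profile Q P) !pairing0l !pairing0r.
rewrite !(mulr0, mul0r, addr0, add0r).
have LL : 0 <= L <= L by rewrite lexx ltW.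
have sZ : L2 L (fun=> 0 : R[i]) by exact: L2_cst.
have eZ : aeq L (fun=> 0 : R[i]) (fun=> 0) by exact: aeq_refl.
have [n1 n2] := wDn_null 1 sZ eZ.
have -> : f4 (A static) = Complex 0 1 * (1 / (Cp * Res))%:C%C.
  rewrite (_ : f4 (A static) = Complex 0 1 * (CD / Cp)%:C%C * trace L (wDn L 1 (fun=> 0)) L
      + Complex 0 1 * (1 / (Cp * Res))%:C%C * 1); last by reflexivity.
  by rewrite (null_trace LL n1 n2) mulr0 add0r mulr1.
rewrite -[f4 static]/(1 : R[i]).
have r0 : 0 < (1 / (Cp * Res)) by rewrite divr_gt0// mulr_gt0.
set r := 1 / _ in r0 *; move=> /(congr1 (@complex.Im R)) /=.
have : 0 < Cp * r by rewrite mulr_gt0.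
set y := Cp * r => y0 h.
have : y = - y by move: h; rewrite /y; lra.
lra.
Qed.

End Examples.

Theorem proposition2p4 (R : realType)
    (L m J S E G Cp Res k1 k2 CI CD : R)
    (L_gt0 : 0 < L) (m_gt0 : 0 < m) (J_gt0 : 0 < J) (S_gt0 : 0 < S)
    (E_gt0 : 0 < E) (G_gt0 : 0 < G) (Cp_gt0 : 0 < Cp) (Res_gt0 : 0 < Res)
    (k1_gt0 : 0 < k1) (k2_gt0 : 0 < k2) (CI_gt0 : 0 < CI) (CD_lt0 : CD < 0)
    (D_gt0 : 0 < m * J - S ^+ 2)
    (S_lt : 0 < S < Num.min m J) :
  let H := beam_space L in
  let eqH := beam_eq L in
  let dot := beam_dot L m J S E G Cp in
  let domA := beam_dom L E G k1 k2 CI in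
  let A := beam_op L m J S E G Cp Res CD in
  [/\ ~ bounded_operator dot domA A,
      closed_operator H eqH dot domA A &
      ~ selfadjoint_operator H eqH dot domA A].
Proof.
have /andP[_] := S_lt; rewrite lt_min => /andP[Sm SJ] H eqH dot domA A; split.
- exact: beam_op_unbounded.
- exact: beam_op_closed.
- exact: beam_op_not_selfadjoint.
Qed.
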